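(* Let $g$ be a metric on probability distributions (not assumed to come from an inner product) satisfying: (M0) $g_{p}(\delta)\ge g_{\Psi(p)}(\Psi(\delta))$ for every local data $\{p,\delta\}$ on a sample space $\Omega$ and every Markov map $\Psi$ from $\Omega$ to a sample space $\Omega'$; (A0) $\lim_{n\to\infty}\frac1n g_{p^{\otimes n}}(\delta^{(n)})=g_p(\delta)$ for every local data $\{p,\delta\}$; (C0) for every local data $\{p,\delta\}$ on $\Omega$ and every sequence of local data $\{q^n,\delta'^n\}$ on $\Omega^{\times n}$ with $\|q^n-p^{\otimes n}\|_1\to0$ and $\frac1{\sqrt n}\|\delta'^n-\delta^{(n)}\|_1\to0$, one has $\liminf_{n\to\infty}\frac1n\left(g_{q^n}(\delta'^n)-g_{p^{\otimes n}}(\delta^{(n)})\right)\ge0$; (N0) $g_{\mathrm N(0,1)}(\delta\mathrm N(0,1))=1$. Let $\{p,\delta\}$ be local data, let $L=\delta/p$, regarded as a real random variable under $p$, and let $J=J_p(\delta)$. Suppose that either (a) $\{p,\delta\}$ is defined over a finite set, or (b) the law of $L$ under $p$ has a probability density $\mathrm p_L$ with respect to Lebesgue measure on $\mathbb R$, and $$\mathbb E\left(\frac{\int_{-\infty}^{L}(-t)\,\mathrm p_L(t)\,\mathrm dt}{J\,\mathrm p_L(L)}\right)^2<\infty .$$ If moreover $\mathbb E_p L^4<\infty$, then $g_p(\delta)=J_p(\delta)$.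
   Context: Sample spaces $\Omega$ are finite sets, $\mathbb R^d$, and finite products of these, each with its standard reference measure $\mu$ (counting measure, Lebesgue measure, and products). $\mathcal P(\Omega)$ is the set of probability densities with respect to $\mu$; a density is identified with its distribution. $\mathcal T_p(\mathcal P)$, the tangent space at $p$, is identified with the set of $L^1$ functions of the form $c(p_1-p_2)$ with $c\in\mathbb R$, $p_1,p_2\in\mathcal P(\Omega)$. Local data $\{p,\delta\}$ on $\Omega$ is a pair $p\in\mathcal P(\Omega)$, $\delta\in\mathcal T_p(\mathcal P)$ for which $L(x)=\delta(x)/p(x)$ is defined ($\delta=0$ a.e. where $p=0$) and the Fisher information $J_p(\delta):=\int L(x)^2p(x)\,\mathrm d\mu(x)=\int \delta(x)^2/p(x)\,\mathrm d\mu(x)$ is finite. A Markov map $\Psi$ from $\Omega$ to $\Omega'$ is a linear map $L^1(\Omega)\to L^1(\Omega')$ given by a Markov kernel and sending probability densities to probability densities; $\Psi(\delta)$ is the same linear map applied to $\delta$. A metric $g$ assigns to every local data $\{p,\delta\}$ (on every sample space) a real number $g_p(\delta)\ge 0$ such that, for each fixed $p$, $\delta\mapsto\sqrt{g_p(\delta)}$ is a norm on the linear space of those $\delta$ for which $\{p,\delta\}$ is local data. $p^{\otimes n}$ is the $n$-fold product density on $\Omega^{\times n}$, and $\delta^{(n)}:=\delta\otimes p^{\otimes n-1}+p\otimes\delta\otimes p^{\otimes n-2}+\cdots+p^{\otimes n-1}\otimes\delta$. $\|\cdot\|_1$ is the $L^1$ norm. $\mathrm N(0,1)$ is the standard Gaussian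 density $\varphi(x)=\frac1{\sqrt{2\pi}}e^{-x^2/2}$ on $\mathbb R$, and $\delta\mathrm N(0,1)$ is the function $x\varphi(x)$. *)

(* Defs.v *)
(* MathComp-Analysis, over an arbitrary realType R. *)
From HB Require Import structures.
From mathcomp Require Import all_boot all_order all_algebra.
From mathcomp Require Import all_classical all_reals all_analysis.

Set Implicit Arguments.
Unset Strict Implicit.
Unset Printing Implicit Defensive.

Import Order.TTheory GRing.Theory Num.Theory.
Import numFieldNormedType.Exports.

Local Open Scope classical_set_scope.
Local Open Scope ring_scope.

(* A finite type with the discrete sigma-algebra. A measurableType has to be
   pointed, whence the base point x0: exactly the nonempty finite sets are
   represented (the empty set carries no probability density). *)
Definition discrete_fin (T : finType) (x0 : T) : Type := T.

Section discrete_fin_instances.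
Variables (T : finType) (x0 : T).

HB.instance Definition _ := Finite.on (discrete_fin x0).
HB.instance Definition _ := isPointed.Build (discrete_fin x0) x0.
HB.instance Definition _ := @isMeasurable.Build default_measure_display
  (discrete_fin x0) discrete_measurable discrete_measurable0
  discrete_measurableC discrete_measurableU.

End discrete_fin_instances.

Definition counting_fin (R : realType) (T : finType) (x0 : T) :
  set (discrete_fin x0) -> \bar R := @counting (discrete_fin x0) R.

Section counting_fin_instances.
Variables (R : realType) (T : finType) (x0 : T).

HB.instance Definition _ := Measure.on (@counting_fin R T x0).

Lemma sigma_finite_counting_fin :
  sigma_finite [set: discrete_fin x0] (@counting_fin R T x0).
Proof.
exists (fun=> setT); first by rewrite bigcup_const//; exists 0%N.
move=> _; split; first exact: measurableT.
by rewrite /counting_fin /counting asboolT ?ltry//; exact: finite_finset.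
Qed.

HB.instance Definition _ := @Measure_isSigmaFinite.Build _ _ _
  (@counting_fin R T x0) sigma_finite_counting_fin.

End counting_fin_instances.

(* The library's product measure, renamed so that its sigma-finiteness can be
   registered for arbitrary sigma-finite factors. *)
Definition prod_measure (R : realType) d1 d2 (T1 : measurableType d1)
    (T2 : measurableType d2) (m1 : {sigma_finite_measure set T1 -> \bar R})
    (m2 : {sigma_finite_measure set T2 -> \bar R}) :
  set (T1 * T2) -> \bar R := (m1 \x m2)%E.

Section prod_measure_instances.
Variables (R : realType) (d1 d2 : measure_display).
Variables (T1 : measurableType d1) (T2 : measurableType d2).
Variable m1 : {sigma_finite_measure set T1 -> \bar R}.
Variable m2 : {sigma_finite_measure set T2 -> \bar R}.

HB.instance Definition _ := Measure.on (prod_measure m1 m2).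

Lemma sigma_finite_prod_measure : sigma_finite setT (prod_measure m1 m2).
Proof.
have /sigma_finiteP[F [TF ndF Foo]] := sigma_finiteT m1.
have /sigma_finiteP[G [TG ndG Goo]] := sigma_finiteT m2.
exists (fun n => F n `*` G n).
  rewrite -setXTT TF TG predeqE => -[x y]; split.
    move=> [/= [n _ Fnx] [k _ Gky]]; exists (maxn n k) => //; split.
    - by move: x Fnx; exact/subsetPset/ndF/leq_maxl.
    - by move: y Gky; exact/subsetPset/ndG/leq_maxr.
  by move=> [n _ []/= ? ?]; split; exists n.
move=> k; have [? ?] := Foo k; have [? ?] := Goo k.
split; first exact: measurableX.
by rewrite /prod_measure product_measure1E// lte_mul_pinfty// ge0_fin_numE.
Qed.

HB.instance Definition _ := @Measure_isSigmaFinite.Build _ _ _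
  (prod_measure m1 m2) sigma_finite_prod_measure.

End prod_measure_instances.

(* Sample spaces: finite sets, the real line, and finite products; R^d is
   spow SReal d below. *)
Inductive sample_space : Type :=
| SFin (T : finType) (x0 : T)
| SReal
| SProd (S1 S2 : sample_space).

Record measure_space (R : realType) := MeasureSpace {
  ms_display : measure_display ;
  ms_type : measurableType ms_display ;
  ms_measure : {sigma_finite_measure set ms_type -> \bar R} }.

Definition fin_space (R : realType) (T : finType) (x0 : T) : measure_space R :=
  @MeasureSpace R _ (discrete_fin x0) (@counting_fin R T x0).

Definition real_space (R : realType) : measure_space R :=
  @MeasureSpace R _ (measurableTypeR R) (@lebesgue_measure R).

Definition prod_space (R : realType) (X Y : measure_space R) :
    measure_space R :=
  @MeasureSpace R _ (ms_type X * ms_type Y)%type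
    (prod_measure (ms_measure X) (ms_measure Y)).

Fixpoint space_of (R : realType) (S : sample_space) : measure_space R :=
  match S with
  | SFin T x0 => fin_space R x0
  | SReal => real_space R
  | SProd S1 S2 => prod_space (space_of R S1) (space_of R S2)
  end.

Definition carrier (R : realType) (S : sample_space) :
  measurableType (ms_display (space_of R S)) := ms_type (space_of R S).

Definition refm (R : realType) (S : sample_space) :
  {sigma_finite_measure set (carrier R S) -> \bar R} :=
  ms_measure (space_of R S).

(* The n-fold product, as S x (S x (... x point)). *)
Fixpoint spow (S : sample_space) (n : nat) : sample_space :=
  if n is m.+1 then SProd S (spow S m) else SFin tt.

Section LocalData.
Variables (R : realType) (S : sample_space).
Local Notation T := (carrier R S).
Local Notation mu := (refm R S).

(* Elements of L^1 are represented by functions, compared up to mu-null sets. *)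
Definition L1fun (f : T -> R) : Prop := mu.-integrable setT (EFin \o f).

Definition ae_equal (f h : T -> R) : Prop := \forall x \ae mu, f x = h x.

Definition density (p : T -> R) : Prop :=
  [/\ L1fun p, \forall x \ae mu, 0 <= p x & (\int[mu]_x (p x)%:E = 1)%E].

Definition tangent (d : T -> R) : Prop :=
  L1fun d /\ exists (c : R) (p1 p2 : T -> R),
    [/\ density p1, density p2 & ae_equal d (fun x => c * (p1 x - p2 x))].

Definition expect (p X : T -> R) : \bar R := (\int[mu]_x (X x * p x)%:E)%E.

(* Since x / 0 = 0, the score vanishes where p does. *)
Definition score (p d : T -> R) : T -> R := fun x => d x / p x.

Definition fisher (p d : T -> R) : \bar R :=
  expect p (fun x => score p d x ^+ 2).

Definition local_data (p d : T -> R) : Prop :=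
  [/\ density p, tangent d, \forall x \ae mu, (p x = 0 -> d x = 0)
    & (fisher p d < +oo)%E].

(* "The law of X under p has density pX". *)
Definition law_density (p X : T -> R) (pX : R -> R) : Prop :=
  forall B : set R, measurable B ->
    (\int[mu]_(x in X @^-1` B) (p x)%:E
     = \int[@lebesgue_measure R]_(t in B) (pX t)%:E)%E.

Definition L1norm (f : T -> R) : \bar R := 'N[mu]_1[EFin \o f].

End LocalData.

Arguments L1fun {R} S f.
Arguments ae_equal {R} S f h.
Arguments density {R} S p.
Arguments tangent {R} S d.
Arguments expect {R} S p X.
Arguments score {R} S p d.
Arguments fisher {R} S p d.
Arguments local_data {R} S p d.
Arguments law_density {R} S p X pX.
Arguments L1norm {R} S f.

(* Here K x B is the probability of B given x, so the second clause says that
   Psi f is the density of B |-> \int f(x) K(x, B) dx. *)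
Definition markov_map (R : realType) (S S' : sample_space)
    (Psi : (carrier R S -> R) -> (carrier R S' -> R)) : Prop :=
  [/\ forall (a : R) (f h : carrier R S -> R), L1fun S f -> L1fun S h ->
        ae_equal S' (Psi (fun x => a * f x + h x))
                    (fun y => a * Psi f y + Psi h y),
      exists K : R.-pker (carrier R S) ~> (carrier R S'),
        forall f : carrier R S -> R, L1fun S f ->
          L1fun S' (Psi f) /\
          forall B : set (carrier R S'), measurable B ->
            (\int[refm R S']_(y in B) (Psi f y)%:E
             = \int[refm R S]_x ((f x)%:E * K x B))%E
    & forall p : carrier R S -> R, density S p -> density S' (Psi p)].

(* f 0 (x) f 1 (x) ... (x) f (n - 1) *)
Fixpoint tensor (R : realType) (S : sample_space)
    (f : nat -> carrier R S -> R) (n : nat) : carrier R (spow S n) -> R :=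
  match n return carrier R (spow S n) -> R with
  | 0 => fun=> 1
  | m.+1 => fun x : carrier R S * carrier R (spow S m) =>
              f 0%N x.1 * @tensor R S (fun i => f i.+1) m x.2
  end.
Arguments tensor {R S} f n _.

Definition tpow (R : realType) (S : sample_space) (p : carrier R S -> R)
    (n : nat) : carrier R (spow S n) -> R := tensor (fun=> p) n.

Arguments tpow {R S} p n _.

Definition tderiv (R : realType) (S : sample_space) (p d : carrier R S -> R)
    (n : nat) : carrier R (spow S n) -> R :=
  fun x => \sum_(i < n) tensor (fun j => if j == i then d else p) n x.

Arguments tderiv {R S} p d n _.

Section Metric.
Variable R : realType.

(* Values outside local data are irrelevant. *)
Definition prob_functional : Type :=
  forall S : sample_space, (carrier R S -> R) -> (carrier R S -> R) -> R.

Implicit Type g : prob_functional.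

(* The first clause says that g is a function of the a.e. classes of p and d;
   the last three that sqrt (g p _) is a norm on the a.e. classes. *)
Definition prob_metric g : Prop :=
  [/\ forall S p p' d d', local_data S p d -> local_data S p' d' ->
        ae_equal S p p' -> ae_equal S d d' -> g S p d = g S p' d',
      forall S p d, local_data S p d -> 0 <= g S p d,
      forall S p d, local_data S p d ->
        (Num.sqrt (g S p d) = 0 <-> ae_equal S d (fun=> 0)),
      forall S p (a : R) d, local_data S p d ->
        Num.sqrt (g S p (fun x => a * d x)) = `|a| * Num.sqrt (g S p d)
    & forall S p d d', local_data S p d -> local_data S p d' ->
        Num.sqrt (g S p (fun x => d x + d' x))
          <= Num.sqrt (g S p d) + Num.sqrt (g S p d')].

Definition markov_monotone g : Prop :=
  forall S S' p d (Psi : (carrier R S -> R) -> (carrier R S' -> R)),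
    local_data S p d -> markov_map Psi -> g S' (Psi p) (Psi d) <= g S p d.

Definition asymp_additive g : Prop :=
  forall S p d, local_data S p d ->
    (fun n : nat => n%:R^-1 * g (spow S n) (tpow p n) (tderiv p d n)) @ \oo
      --> g S p d.

Definition asymp_lower_continuous g : Prop :=
  forall S p d (q d' : forall n : nat, carrier R (spow S n) -> R),
    local_data S p d ->
    (forall n, local_data (spow S n) (q n) (d' n)) ->
    (fun n => L1norm (spow S n) (fun x => q n x - tpow p n x)) @ \oo
      --> 0%E ->
    (fun n => (Num.sqrt n%:R)^-1%:E
              * L1norm (spow S n) (fun x => d' n x - tderiv p d n x)%R)%E @ \oo
      --> 0%E ->
    (0 <= limn_einf (fun n =>
       (n%:R^-1 * (g (spow S n) (q n) (d' n)
                   - g (spow S n) (tpow p n) (tderiv p d n)))%:E))%E.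

Definition gaussian_normalized g : Prop :=
  g SReal (normal_pdf 0 1) (fun x : R => x * normal_pdf 0 1 x) = 1.

End Metric.

Definition stein_ratio (R : realType) (J : R) (pL : R -> R) (y : R) : R :=
  (\int[@lebesgue_measure R]_(t in `]-oo, y]) (- t * pL t)) / (J * pL y).

(* The random variable in the expectation is squared: what is required is the
   finiteness of its second moment. *)
Definition stein_condition (R : realType) (S : sample_space)
    (p d : carrier R S -> R) : Prop :=
  let L := score S p d in
  let J := fine (fisher S p d) in
  exists pL : R -> R,
    [/\ density SReal pL, law_density S p L pL
      & (expect S p (fun x => stein_ratio J pL (L x) ^+ 2)%R < +oo)%E].

(* Main.v *)
(* Two local data with the same Fisher information J, whose scores have a fourth
   moment, have the same g; taking the normal density as one of them and using
   the normalization gives g = J.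

   To compare {p, L p} with {q, K q}, fix k > 0 and put W = k / sqrt n * sum L_i
   and V = k / sqrt n * sum K_i on the n-fold powers.  With Z standard normal,
   the channel x |-> W x + Z followed by the Bayes channel of x' |-> V x' + Z is a
   Markov map from the n-th power of p to that of q.  It would hit the n-th power
   of q exactly if W + Z and V + Z had the same density, and Lindeberg's argument
   shows that these densities r, s satisfy sup |r - s| = O(1 / sqrt n), hence,
   their second moments being bounded, that (1 + |y|) (r - s) tends to 0 in L^1.
   The noise Z turns the tangent vector into that of W + Z at a cost of order
   sqrt n / k in the norm, by the triangle inequality and monotonicity.
   Additivity and lower continuity then give
   sqrt (g_q) <= sqrt (g_p) + C / k, and k is arbitrary. *)
From HB Require Import structures.
Require Import Defs.
From mathcomp Require Import all_boot all_order all_algebra.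
From mathcomp Require Import all_classical all_reals all_analysis.
From mathcomp Require Import measurable_realfun lra ring.

Set Implicit Arguments.
Unset Strict Implicit.
Unset Printing Implicit Defensive.

Import Order.TTheory GRing.Theory Num.Theory.
Import numFieldNormedType.Exports.

Local Open Scope classical_set_scope.
Local Open Scope ring_scope.

(** * Integration *)

(** The obstacle is that lower continuity asks for closeness in L^1, while normalized sums of scores
    converge only in law and may have atoms. Adding Z turns the laws into averages of translates of
    one smooth function, so that their densities can be compared pointwise by Taylor expansion. The
    means vanish and the variances agree because the two Fisher informations do, so exchanging one
    summand costs only the third order, (k / sqrt n)^3, and n exchanges cost k^3 / sqrt n. The
    fourth moment enters through |t|^3 <= 1 + t^4.

    The weight |y| comes from the tangent vectors: the score sum is sqrt n / k times W, so the error
    of the tangent vector is sqrt n / k times the L^1 norm of y (r - s), and the factor 1 / sqrt n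
    in the lower continuity hypothesis just compensates this growth.

    Since k stays fixed while n grows, bounds may depend on k in any way. The price of the noise is
    paid in sqrt g, where the triangle inequality is available. Comparison is one-sided, and
    exchanging the two data gives the other inequality. *)

Section translation.
Variable R : realType.
Local Notation mu := (@lebesgue_measure R).

(** By uniqueness: the image measure agrees with Lebesgue measure on half-open intervals. *)
Lemma lebesgue_measure_translation (w : R) (A : set R) : measurable A ->
  pushforward mu (fun y : measurableTypeR R => y - w : measurableTypeR R) A = mu A.
Proof.
have mw : measurable_fun setT (fun y : measurableTypeR R => y - w : measurableTypeR R).
  exact: measurable_funB.
move=> mA; apply/esym; pose nu := pushforward mu (fun y : measurableTypeR R => y - w : measurableTypeR R).
rewrite -/nu.
apply: (@lebesgue_measure_unique R nu) => //= _ [[a b]] _ <-.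
rewrite /nu /pushforward.
have -> : (fun y => y - w) @^-1` `]a, b] = `]a + w, b + w]%classic.
  by apply/seteqP; split => y /=; rewrite !in_itv/= ltrBrDr lerBlDr.
by rewrite !lebesgue_measure_itv/= !lte_fin ltrD2r !EFinD; case: ifP => // _; rewrite -!EFinD opprD addrACA subrr addr0.
Qed.

Lemma measurable_translation (w : R) :
  measurable_fun setT (fun y : measurableTypeR R => y - w : measurableTypeR R).
Proof. exact: measurable_funB. Qed.

Lemma ge0_integral_translation (w : R) (f : R -> \bar R) :
  measurable_fun [set: R] f -> (forall x, (0 <= f x)%E) ->
  (\int[mu]_y f (y - w)%R = \int[mu]_y f y)%E.
Proof.
move=> mf f0.
transitivity (\int[pushforward mu (fun y : measurableTypeR R => (y - w)%R : measurableTypeR R)]_y f y)%E.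
  by rewrite (ge0_integral_pushforward (measurable_translation w)).
apply: eq_measure_integral; first exact: measurable_translation.
by move=> mt A mA _; exact: lebesgue_measure_translation.
Qed.

Lemma integral_translation (w : R) (f : R -> \bar R) :
  measurable_fun [set: R] f ->
  (\int[mu]_y f (y - w)%R = \int[mu]_y f y)%E.
Proof.
move=> mf; rewrite integralE [RHS]integralE.
have P : (\int[mu]_y (f^\+ (y - w)%R) = \int[mu]_y f^\+ y)%E.
  by apply: ge0_integral_translation => //; exact: measurable_funepos.
have N : (\int[mu]_y (f^\- (y - w)%R) = \int[mu]_y f^\- y)%E.
  by apply: ge0_integral_translation => //; exact: measurable_funeneg.
by rewrite -P -N funepos_comp funeneg_comp.
Qed.

End translation.

Section product_integrals.
Context d1 d2 (T1 : measurableType d1) (T2 : measurableType d2) (R : realType).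
Variable m1 : {sigma_finite_measure set T1 -> \bar R}.
Variable m2 : {sigma_finite_measure set T2 -> \bar R}.

Lemma measurable_tensor (f : T1 -> R) (g : T2 -> R) :
  measurable_fun setT f -> measurable_fun setT g ->
  measurable_fun setT (fun z : T1 * T2 => f z.1 * g z.2).
Proof.
by move=> mf mg; apply: measurable_funM; apply: measurableT_comp.
Qed.

Lemma integrable_tensor (f : T1 -> R) (g : T2 -> R) :
  m1.-integrable setT (EFin \o f) -> m2.-integrable setT (EFin \o g) ->
  (m1 \x m2)%E.-integrable setT (EFin \o (fun z : T1 * T2 => f z.1 * g z.2)).
Proof.
move=> fi gi; have mf := measurable_int _ fi; have mg := measurable_int _ gi.
have rf : measurable_fun setT f by exact/measurable_EFinP.
have rg : measurable_fun setT g by exact/measurable_EFinP.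
have mfg : measurable_fun setT (EFin \o (fun z : T1 * T2 => f z.1 * g z.2)).
  by apply/measurable_EFinP; apply: measurable_tensor.
apply: (integrable12ltyP _ _ mfg).2 => /=.
rewrite (eq_integral (fun x => `|(f x)%:E| * \int[m2]_y `|(g y)%:E|)%E); last first.
  move=> x _; rewrite -ge0_integralZl//; last exact/measurableT_comp.
  by apply: eq_integral => y _; rewrite -abseM.
rewrite ge0_integralZr//; last 2 first.
  exact/measurableT_comp.
  exact: integral_ge0.
move/integrableP : fi => [_ fi]; move/integrableP : gi => [_ gi].
by rewrite lte_mul_pinfty// ?integral_ge0// ge0_fin_numE// integral_ge0.
Qed.

Lemma Rintegral_tensor (f : T1 -> R) (g : T2 -> R) :
  m1.-integrable setT (EFin \o f) -> m2.-integrable setT (EFin \o g) ->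
  \int[(m1 \x m2)%E]_z (f z.1 * g z.2) = (\int[m1]_x f x) * (\int[m2]_y g y).
Proof.
move=> fi gi; have fgi := integrable_tensor fi gi.
rewrite /Rintegral -(integral12_prod_meas1 fgi)/fubini_F/=.
rewrite (eq_integral (fun x => ((f x)%:E * (fine (\int[m2]_y (g y)%:E))%:E)%E)); last first.
  move=> x _; rewrite fineK; last exact: integrable_fin_num.
  by rewrite -integralZl//; apply: eq_integral => y _; rewrite EFinM.
rewrite integralZr// fineM//; exact: integrable_fin_num.
Qed.

End product_integrals.

Section real_integrals.
Context d (T : measurableType d) (R : realType).
Variable mu : {measure set T -> \bar R}.

Lemma integrableZ_EFin (k : R) (f : T -> R) : mu.-integrable setT (EFin \o f) ->
  mu.-integrable setT (EFin \o (fun x => k * f x)).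
Proof.
by move=> fi; have : mu.-integrable setT (fun x => (k%:E * (f x)%:E)%E) by exact: integrableZl.
Qed.

Lemma integral_of_Rintegral (f : T -> R) (v : R) : mu.-integrable setT (EFin \o f) ->
  \int[mu]_x f x = v -> (\int[mu]_x (f x)%:E = v%:E)%E.
Proof. by move=> fi <-; rewrite fineK//; exact: integrable_fin_num. Qed.

Lemma integral_indicr (f : T -> R) (B : set T) : measurable B ->
  (\int[mu]_(x in B) (f x)%:E = \int[mu]_x (f x * \1_B x)%:E)%E.
Proof.
move=> mB; rewrite integral_mkcond; apply: eq_integral => x _.
by rewrite /patch indicE; case: (x \in B); rewrite ?mulr1 ?mulr0.
Qed.

End real_integrals.

(** * Markov maps and local data *)

Section ae_sign.
Context d (T : measurableType d) (R : realType).
Variable mu : {measure set T -> \bar R}.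

Lemma integral_ae_ge0 (f : T -> \bar R) : measurable_fun setT f ->
  (\forall x \ae mu, (0 <= f x)%E) -> (0 <= \int[mu]_x f x)%E.
Proof.
move=> mf f0; rewrite (@ae_eq_integral _ _ _ mu setT (abse \o f))//.
- by apply: integral_ge0 => x _; exact: abse_ge0.
- exact: measurableT_comp.
- by apply: filterS f0 => x fx _; rewrite /= gee0_abs.
Qed.

(** Test the hypothesis on the set where [h] is negative. This turns information on a kernel, which
    concerns integrals over sets, into pointwise positivity of the image function. *)
Lemma ae_ge0_integral (h : T -> R) : mu.-integrable setT (EFin \o h) ->
  (forall B, measurable B -> (0 <= \int[mu]_(x in B) (h x)%:E)%E) ->
  \forall x \ae mu, 0 <= h x.
Proof.
move=> hi h0; have mh : measurable_fun setT h.
  exact/measurable_EFinP/(measurable_int _ hi).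
pose B := [set x | h x < 0].
have mB : measurable B.
  by rewrite /B -[X in measurable X]setTI; exact: measurable_fun_ltr.
have : (\int[mu]_(x in B) `|(h x)%:E| = 0)%E.
  apply/eqP; rewrite eq_le integral_ge0// andbT.
  rewrite (_ : (\int[mu]_(x in B) `|(h x)%:E| = - \int[mu]_(x in B) (h x)%:E)%E).
    by rewrite oppe_le0 h0.
  rewrite -integralN /=.
    by apply: eq_integral => x; rewrite inE /B/= => hx; rewrite ltr0_norm.
  by apply: integrable_add_def => //; exact: integrableS hi.
move/(ae_eq_integral_abs mu mB (measurable_funS measurableT (@subsetT _ _) (measurable_int _ hi))).1.
apply: filterS => x; rewrite /B/= => hx; rewrite leNgt; apply/negP => hx0.
by have := hx hx0 => -[] hx'; rewrite hx' ltxx in hx0.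
Qed.

End ae_sign.

Section markov.
Variables (R : realType) (S S' : sample_space).
Local Notation mu := (refm R S).
Local Notation mu' := (refm R S').
Local Notation T := (carrier R S).
Local Notation T' := (carrier R S').
Implicit Types (Psi : (T -> R) -> T' -> R).

Lemma L1fun_measurable S0 (f : carrier R S0 -> R) : L1fun S0 f -> measurable_fun setT f.
Proof. by move=> fi; apply/measurable_EFinP; exact: (measurable_int _ fi). Qed.

Lemma kernel_le1 (K : R.-pker T ~> T') x (B : set T') : measurable B -> (K x B <= 1)%E.
Proof. by move=> mB; rewrite -(prob_kernel (s:=K) x) le_measure// inE. Qed.

Lemma integrable_kernel (K : R.-pker T ~> T') (f : T -> R) (B : set T') :
  L1fun S f -> measurable B -> mu.-integrable setT (fun x => ((f x)%:E * K x B)%E).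
Proof.
move=> fi mB; apply: (le_integrable _ _ _ fi) => //.
  apply: emeasurable_funM; first exact: (measurable_int _ fi).
  exact: measurable_kernel.
move=> x _; rewrite abseM (gee0_abs (measure_ge0 _ _)) -[leRHS]mule1.
rewrite lee_wpmul2l//.
exact: kernel_le1.
Qed.

(** The kernel formula carries the other two clauses: integrals over all measurable sets determine a
    function up to a null set, which gives linearity, and they detect its sign and its mass. *)
Lemma markov_mapI Psi :
  (exists K : R.-pker T ~> T', forall f, L1fun S f ->
    L1fun S' (Psi f) /\ forall B, measurable B ->
    (\int[mu']_(y in B) (Psi f y)%:E = \int[mu]_x ((f x)%:E * K x B))%E) ->
  markov_map Psi.
Proof.
move=> [K HK]; split; last 2 first.
- by exists K.
- move=> p [pi p0 p1]; have [Pi PK] := HK _ pi; split => //.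
    apply: ae_ge0_integral => // B mB; rewrite PK//.
    apply: integral_ae_ge0; first exact: (measurable_int _ (integrable_kernel K pi mB)).
    by apply: filterS p0 => x p0; rewrite mule_ge0.
  rewrite PK// -p1; apply: eq_integral => x _.
  by rewrite prob_kernel mule1.
- move=> a f h fi hi.
  have afi : mu.-integrable setT (fun x => (a%:E * (f x)%:E)%E) by exact: integrableZl.
  have afhi : L1fun S (fun x => a * f x + h x).
    by apply: eq_integrable (integrableD measurableT afi hi) => // x _.
  have [Lf Kf] := HK _ fi; have [Lh Kh] := HK _ hi; have [Lafh Kafh] := HK _ afhi.
  have aLf : mu'.-integrable setT (fun x => (a%:E * (Psi f x)%:E)%E) by exact: integrableZl.
  have : ae_eq mu' setT (EFin \o Psi (fun x => a * f x + h x))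
      (fun y => a%:E * (Psi f y)%:E + (Psi h y)%:E)%E.
    apply: integral_ae_eq => //.
      by apply: emeasurable_funD; [exact: (measurable_int _ aLf)|exact: (measurable_int _ Lh)].
    move=> B _ mB; rewrite [LHS]Kafh// integralD//; last 2 first.
      exact: integrableS aLf.
      exact: integrableS Lh.
    rewrite integralZl//; last exact: integrableS Lf.
    rewrite Kf// Kh//.
    have fK := integrable_kernel K fi mB; have hK := integrable_kernel K hi mB.
    rewrite -integralZl// -integralD//; last exact: integrableZl.
    apply: eq_integral => x _; rewrite EFinD EFinM muleDl ?muleA//.
    by rewrite ge0_fin_numE// (le_lt_trans _ (ltry 1))// kernel_le1.
  by apply: filterS => y /(_ I) [].
Qed.

Section properties.
Variable Psi : (T -> R) -> T' -> R.
Hypothesis M : markov_map Psi.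

Lemma markov_L1 f : L1fun S f -> L1fun S' (Psi f).
Proof. by move=> fi; have [_ [K /(_ _ fi)[]]] := M. Qed.

Lemma markov_linear a f h : L1fun S f -> L1fun S h ->
  ae_equal S' (Psi (fun x => a * f x + h x)) (fun y => a * Psi f y + Psi h y).
Proof. by have [+ _ _] := M; exact. Qed.

Lemma markov_integral f : L1fun S f ->
  (\int[mu']_y (Psi f y)%:E = \int[mu]_x (f x)%:E)%E.
Proof.
move=> fi; have [_ [K /(_ _ fi)[_ ->//]] _] := M.
by apply: eq_integral => x _; rewrite prob_kernel mule1.
Qed.

Lemma markov_ge0 f : L1fun S f -> (\forall x \ae mu, 0 <= f x) ->
  \forall y \ae mu', 0 <= Psi f y.
Proof.
move=> fi f0; have [_ [K /(_ _ fi)[Pi PK]] _] := M.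
apply: ae_ge0_integral => // B mB; rewrite PK//.
apply: integral_ae_ge0; first exact: (measurable_int _ (integrable_kernel K fi mB)).
by apply: filterS f0 => x p0; rewrite mule_ge0.
Qed.

(** Positivity of [Psi] on [s * e + |e|] for [s = 1] and [s = -1], where [e = f - h], gives
    [|Psi e| <= Psi |e|] almost everywhere, and [Psi] preserves integrals. *)
Lemma markov_contraction f h : L1fun S f -> L1fun S h ->
  (L1norm S' (fun y => (Psi f y - Psi h y)%R) <= L1norm S (fun x => (f x - h x)%R))%E.
Proof.
move=> fi hi; pose e x := f x - h x.
have ei : L1fun S e by exact: (integrableB measurableT fi hi).
have ai : L1fun S (fun x => `|e x|) by exact: integrable_norm.
have e1 : ae_equal S' (Psi e) (fun y => Psi f y - Psi h y).
  have := markov_linear (-1) hi fi; congr (ae_equal _ _ _).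
    by congr Psi; apply/funext => x; rewrite mulN1r addrC.
  by apply/funext => y; rewrite mulN1r addrC.
have pos s : (`|s| <= 1)%R -> \forall y \ae mu', 0 <= s * Psi e y + Psi (fun x => `|e x|) y.
  move=> s1; have L := markov_linear s ei ai.
  have si : L1fun S (fun x => s * e x + `|e x|).
    have sei : mu.-integrable setT (fun x => (s%:E * (e x)%:E)%E) by exact: integrableZl.
    by apply: eq_integrable (integrableD measurableT sei ai) => // x _.
  have P : \forall y \ae mu', 0 <= Psi (fun x => s * e x + `|e x|) y.
    apply: markov_ge0 => //; apply: nearW => x.
    have : `|s * e x| <= `|e x| by rewrite normrM ler_piMl.
    by rewrite ler_norml => /andP[]; lra.
  by near=> y; have <- : Psi (fun x => s * e x + `|e x|) y = s * Psi e y + Psi (fun x => `|e x|) y;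
    near: y.
rewrite /L1norm !Lnorm1.
apply: (@le_trans _ _ (\int[mu']_y (Psi (fun x => `|e x|) y)%:E)%E); last first.
  by rewrite markov_integral.
have Pi := markov_L1 ai.
have mP := L1fun_measurable Pi.
have P0 : \forall y \ae mu', 0 <= Psi (fun x => `|e x|) y.
  by apply: markov_ge0 => //; apply: nearW => x.
rewrite (@ae_eq_integral _ _ _ mu' setT (fun y => `|(Psi (fun x => `|e x|) y)%:E|%E)
  (fun y => (Psi (fun x => `|e x|) y)%:E))//; last 3 first.
- exact/measurable_EFinP.
- by apply: measurableT_comp => //; exact/measurable_EFinP.
- by apply: filterS P0 => y Py _; rewrite /= ger0_norm.
apply: ae_ge0_le_integral => //.
- apply: measurableT_comp => //; apply/measurable_EFinP; apply: measurable_funB; apply: L1fun_measurable; exact: markov_L1.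
- by apply: measurableT_comp => //; exact/measurable_EFinP.
have N1 := pos (-1); have N2 := pos 1; rewrite normrN1 in N1; rewrite normr1 in N2.
have {}e1 : \forall y \ae mu', Psi e y = Psi f y - Psi h y := e1.
have {}N1 := N1 (lexx _); have {}N2 := N2 (lexx _).
apply: filterS3 N1 N2 (filterI e1 P0) => y n1 n2 [e1y P0y] _.
rewrite /= lee_fin -e1y (ger0_norm P0y) ler_norml; apply/andP; split; lra.
Unshelve. all: by end_near. Qed.

End properties.
End markov.

Section local_data_theory.
Variables (R : realType) (S : sample_space).
Local Notation mu := (refm R S).
Local Notation T := (carrier R S).
Implicit Types (p d e : T -> R).

Lemma L1funZ (a : R) (f : T -> R) : L1fun S f -> L1fun S (fun x => a * f x).
Proof. exact: integrableZ_EFin. Qed.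

Lemma L1funD (f h : T -> R) : L1fun S f -> L1fun S h -> L1fun S (fun x => f x + h x).
Proof. by move=> fi hi; apply: eq_integrable (integrableD measurableT fi hi) => // x _. Qed.

Lemma ge0_L1fun (f : T -> R) : measurable_fun setT f -> (\forall x \ae mu, 0 <= f x) ->
  (\int[mu]_x (f x)%:E < +oo)%E -> L1fun S f.
Proof.
move=> mf f0 foo; apply/integrableP; split; first exact/measurable_EFinP.
rewrite (@ae_eq_integral _ _ _ mu setT (EFin \o f))//.
- by apply: measurableT_comp => //; exact/measurable_EFinP.
- exact/measurable_EFinP.
- by apply: filterS f0 => x fx _; rewrite /= ger0_norm.
Qed.

Lemma tangent_integral d : tangent S d -> (\int[mu]_x (d x)%:E = 0)%E.
Proof.
move=> [di [c [p1 [p2 [[i1 _ e1] [i2 _ e2] dE]]]]].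
rewrite (@ae_eq_integral _ _ _ mu setT (fun x => (c * (p1 x - p2 x))%:E))//.
- under eq_integral do rewrite EFinM EFinB.
  have ci := integrableB measurableT i1 i2.
  rewrite integralZl// integralB// e1 e2 subee// mule0//.
- exact: (measurable_int _ di).
- apply/measurable_EFinP/measurable_funM => //; apply: measurable_funB; exact: L1fun_measurable.
- by apply: filterS dE => x dE _; rewrite /= dE.
Qed.

(** The positive and negative parts of [d] have a common mass c, and dividing them by c gives the
    two densities. If c = 0 then [d] vanishes almost everywhere, and [p] serves as both
    densities. *)
Lemma tangentI p d : density S p -> L1fun S d -> (\int[mu]_x (d x)%:E = 0)%E -> tangent S d.
Proof.
move=> dp di d0; split => //.
have md := L1fun_measurable di.
pose c := fine (\int[mu]_x (d^\+ x)%:E).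
have pi : L1fun S (d^\+)%R by apply: integrable_funrpos.
have ni : L1fun S (d^\-)%R by apply: integrable_funrneg.
have cE : (\int[mu]_x (d^\+ x)%:E = c%:E)%E by rewrite fineK//; exact: integrable_fin_num.
have c0 : 0 <= c by apply: fine_ge0; apply: integral_ge0 => x _; rewrite lee_fin funrpos_ge0.
have dpn x : d x = d^\+ x - d^\- x by rewrite -[in LHS](funrposBneg d).
have cE' : (\int[mu]_x (d^\- x)%:E = c%:E)%E.
  have : (\int[mu]_x ((d^\+ x)%:E - (d^\- x)%:E) = 0)%E.
    by rewrite -d0; apply: eq_integral => x _; rewrite [in RHS]dpn.
  rewrite integralB// cE -{1}[(\int[mu]_x (d^\- x)%:E)%E]fineK; last exact: integrable_fin_num.
  move=> -[] /eqP; rewrite subr_eq0 => /eqP cc; rewrite [in RHS]cc fineK//.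
  exact: integrable_fin_num.
have [cz|cn0] := eqVneq c 0.
  exists 0, p, p; split => //.
  have := (ae_eq_integral_abs mu measurableT (measurable_int _ di)).1.
  rewrite (_ : (\int[mu]_x `|(d x)%:E| = 0)%E); last first.
    under eq_integral do rewrite abse_EFin.
    rewrite (eq_integral (fun x => (d^\+ x)%:E + (d^\- x)%:E)%E).
      by rewrite integralD// cE cE' cz adde0.
    by move=> x _; rewrite -EFinD -[in LHS]/((Num.norm \o d) x) -funrposDneg.
  move=> /(_ erefl); apply: filterS => x /(_ I)[] ->.
  by rewrite mul0r.
exists c, (fun x => c^-1 * d^\+ x), (fun x => c^-1 * d^\- x); split.
- split; first exact: L1funZ.
    by apply: nearW => x; rewrite mulr_ge0// invr_ge0.
  by under eq_integral do rewrite EFinM; rewrite integralZl// cE -EFinM mulVf.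
- split; first exact: L1funZ.
    by apply: nearW => x; rewrite mulr_ge0// invr_ge0.
  by under eq_integral do rewrite EFinM; rewrite integralZl// cE' -EFinM mulVf.
- by apply: nearW => x; rewrite -mulrBr mulrA divff// mul1r -dpn.
Qed.

End local_data_theory.

Lemma measurable_invr (R : realType) : measurable_fun [set: R] (@GRing.inv R).
Proof.
have -> : [set: R] = [set x | x != 0] `|` [set 0].
  by apply/seteqP; split => x //= _; have [->|x0] := eqVneq x 0; [right|left].
have oN := @open_neq R 0.
rewrite measurable_funU//; last exact: open_measurable.
split; last exact: measurable_fun_set1.
apply: open_continuous_measurable_fun => // x; rewrite inE/= => x0.
exact: inv_continuous.
Qed.

Section ae_comparison.
Context d (T : measurableType d) (R : realType).
Variable mu : {measure set T -> \bar R}.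

Lemma ae_ge0_le_integralr (f h : T -> R) :
  measurable_fun setT f -> measurable_fun setT h ->
  (\forall x \ae mu, 0 <= f x) -> (\forall x \ae mu, f x <= h x) ->
  (\int[mu]_x (f x)%:E <= \int[mu]_x (h x)%:E)%E.
Proof.
have abs (e : T -> R) : measurable_fun setT e -> (\forall x \ae mu, 0 <= e x) ->
    (\int[mu]_x (e x)%:E = \int[mu]_x `|e x|%:E)%E.
  move=> me e0; apply: ae_eq_integral => //.
  - exact/measurable_EFinP.
  - exact/measurable_EFinP/measurableT_comp.
  - by apply: filterS e0 => x e0 _ /=; rewrite ger0_norm.
move=> mf mh f0 fh.
have h0 : \forall x \ae mu, 0 <= h x by apply: filterS2 f0 fh => x; exact: le_trans.
rewrite (abs f)// (abs h)//; apply: ae_ge0_le_integral => //.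
- exact/measurable_EFinP/measurableT_comp.
- exact/measurable_EFinP/measurableT_comp.
by apply: filterS2 f0 fh => x f0 fh _; rewrite lee_fin !ger0_norm// (le_trans f0).
Qed.

End ae_comparison.

Section local_data_closure.
Variables (R : realType) (S : sample_space).
Local Notation mu := (refm R S).
Local Notation T := (carrier R S).
Implicit Types (p d e : T -> R).

Lemma fisherE p d x : score S p d x ^+ 2 * p x = d x ^+ 2 / p x.
Proof.
rewrite /score; have [->|p0] := eqVneq (p x) 0; first by rewrite invr0 !mulr0.
by field.
Qed.

Lemma measurable_div (f h : T -> R) : measurable_fun setT f -> measurable_fun setT h ->
  measurable_fun setT (fun x => f x / h x).
Proof.
move=> mf mh; apply: measurable_funM => //.
exact: (measurableT_comp (@measurable_invr R)).
Qed.

Lemma local_data_measurable p d : local_data S p d ->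
  measurable_fun setT p /\ measurable_fun setT d.
Proof. by move=> [[ip _ _] [id _] _ _]; split; exact: L1fun_measurable. Qed.

Lemma local_data_fisher p d : local_data S p d -> L1fun S (fun x => d x ^+ 2 / p x).
Proof.
move=> ld; have [mp md] := local_data_measurable ld.
case: ld => [[_ p0 _] _ _ foo]; apply: ge0_L1fun.
- by apply: measurable_div => //; exact: measurable_funX.
- by apply: filterS p0 => x p0; rewrite divr_ge0// sqr_ge0.
- by move: foo; rewrite /fisher /expect; under eq_integral do rewrite fisherE.
Qed.

Lemma local_dataI p d : density S p -> L1fun S d -> (\int[mu]_x (d x)%:E = 0)%E ->
  (\forall x \ae mu, (p x = 0 -> d x = 0)) -> L1fun S (fun x => d x ^+ 2 / p x) ->
  local_data S p d.
Proof.
move=> dp di d0 pd Ji; split => //; first exact: tangentI dp di d0.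
rewrite /fisher /expect; under eq_integral do rewrite fisherE.
exact: integrable_lty.
Qed.

Lemma local_dataD p d e : local_data S p d -> local_data S p e ->
  local_data S p (fun x => d x + e x).
Proof.
move=> ld le.
have Jd := local_data_fisher ld; have Je := local_data_fisher le.
have [mp md] := local_data_measurable ld; have [_ me] := local_data_measurable le.
case: ld => [dp td pd _]; case: le => [_ te pe _].
have [id _] := td; have [ie _] := te.
apply: local_dataI => //.
- exact: L1funD.
- by under eq_integral do rewrite EFinD; rewrite integralD// !tangent_integral// adde0.
- by move: pd pe; apply: filterS2 => x pd pe p0; rewrite pd// pe// addr0.
have [_ p0 _] := dp.
have mj : measurable_fun setT (fun x => (d x + e x) ^+ 2 / p x).
  by apply: measurable_div => //; apply: measurable_funX; exact: measurable_funD.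
(* The dominating function is [2 (d^2 + e^2) / p], which exceeds [(d + e)^2 / p] by
   [(d - e)^2 / p]. *)
have J2 := L1funZ 2 (L1funD Jd Je).
apply: ge0_L1fun => //.
  by apply: filterS p0 => x p0; rewrite divr_ge0// sqr_ge0.
apply: le_lt_trans (integrable_lty measurableT J2).
apply: ae_ge0_le_integralr => //.
- exact: L1fun_measurable.
- by apply: filterS p0 => x p0; rewrite divr_ge0// sqr_ge0.
apply: filterS p0 => x p0.
rewrite -mulrDl mulrA ler_wpM2r ?invr_ge0//.
rewrite -subr_ge0 (_ : _ - _ = (d x - e x) ^+ 2) ?sqr_ge0//; by ring.
Qed.

Lemma local_dataZ p (a : R) d : local_data S p d -> local_data S p (fun x => a * d x).
Proof.
move=> ld; have Jd := local_data_fisher ld.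
case: ld => [dp td pd _]; have [id _] := td.
apply: local_dataI => //.
- exact: L1funZ.
- by under eq_integral do rewrite EFinM; rewrite integralZl// tangent_integral// mule0.
- by apply: filterS pd => x pd p0; rewrite pd// mulr0.
apply: eq_integrable (L1funZ (a ^+ 2) Jd) => // x _ /=.
by rewrite exprMn mulrA.
Qed.

End local_data_closure.

(** A discriminant criterion tested on rational t only, so that at almost every point it needs just
    countably many almost sure inequalities. The minimizer b / a may be irrational and is approached
    from above. *)
Lemma quadratic_bound (R : realType) (a b c : R) : 0 <= a ->
  (forall t : rat, 0 <= c - 2 * ratr t * b + ratr t ^+ 2 * a) ->
  (a = 0 -> b = 0) /\ b ^+ 2 / a <= c.
Proof.
move=> a0 H.
have [a_eq0|an0] := eqVneq a 0.
  have b0 : b = 0.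
    apply/eqP/negPn/negP => bn0.
    (* With [a = 0] the polynomial is affine in t; it becomes negative beyond its root c / (2 b), on
       the side given by the sign of b. *)
    have [t tb] : exists t : rat, c < 2 * ratr t * b.
      have cE : c = 2 * (c / (2 * b)) * b by field.
      have [b0|b0] : b < 0 \/ 0 < b by apply/orP; rewrite -neq_lt.
        have lt1 : c / (2 * b) - 1 < c / (2 * b) by lra.
        have [t] := rat_in_itvoo lt1.
        rewrite in_itv/= => /andP[_ tl]; exists t.
        by rewrite {1}cE ltr_nM2r// ltr_pM2l.
      have lt1 : c / (2 * b) < c / (2 * b) + 1 by lra.
      have [t] := rat_in_itvoo lt1.
      rewrite in_itv/= => /andP[tl _]; exists t.
      by rewrite {1}cE ltr_pM2r// ltr_pM2l.
    by have := H t; rewrite a_eq0 mulr0 addr0; lra.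
  by split => //; rewrite b0 expr0n/= mul0r; have := H 0; rewrite rmorph0; lra.
have ap : 0 < a by rewrite lt_neqAle eq_sym an0.
split; first by move=> a0'; rewrite a0' eqxx in an0.
rewrite leNgt; apply/negP => clt.
(* The polynomial equals [a ((t - b / a)^2 - dl)]. Taking [0 < t - b / a < min 1 dl] makes the
   square smaller than [dl] without extracting a root. *)
pose dl := (b ^+ 2 / a - c) / a.
have dap : 0 < dl by rewrite divr_gt0// subr_gt0.
pose eta := Num.min 1 dl.
have ep : 0 < eta by rewrite lt_min ltr01.
have lt1 : b / a < b / a + eta by rewrite ltrDl.
have [t] := rat_in_itvoo lt1.
rewrite in_itv/= => /andP[t1 t2].
have s0 : 0 < ratr t - b / a by rewrite subr_gt0.
have s1 : ratr t - b / a < 1 by rewrite ltrBlDl (lt_le_trans t2)// lerD2l ge_min lexx.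
have s2 : ratr t - b / a < dl by rewrite ltrBlDl (lt_le_trans t2)// lerD2l ge_min lexx orbT.
have E : c - 2 * ratr t * b + ratr t ^+ 2 * a = a * ((ratr t - b / a) ^+ 2 - dl).
  by rewrite /dl; field.
have := H t; rewrite E pmulr_rge0// subr_ge0 leNgt => /negP; apply.
by apply: le_lt_trans s2; rewrite expr2 ger_pMl// ltW.
Qed.

Section markov_local_data.
Variables (R : realType) (S S' : sample_space).
Local Notation mu := (refm R S).
Local Notation mu' := (refm R S').

(* Psi is positive, so applying it to p (d / p - t) ^ 2 >= 0 for every rational t
   makes a quadratic polynomial in t nonnegative almost everywhere; its
   discriminant gives (Psi d) ^ 2 / Psi p <= Psi (d ^ 2 / p). *)
Lemma markov_local_data p d Psi : local_data S p d -> @markov_map R S S' Psi ->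
  local_data S' (Psi p) (Psi d).
Proof.
move=> ld M; have Jd := local_data_fisher ld.
case: ld => [[ip p0 p1] td pd _]; have [id _] := td.
pose e x := d x ^+ 2 / p x.
have Dp : density S' (Psi p) by have [_ _] := M; apply.
have quad (t : R) : \forall y \ae mu', 0 <= Psi e y - 2 * t * Psi d y + t ^+ 2 * Psi p y.
  have ide : L1fun S (fun x => (- 2 * t) * d x + e x) by apply: L1funD => //; exact: L1funZ.
  have ipde : L1fun S (fun x => t ^+ 2 * p x + ((- 2 * t) * d x + e x)).
    by apply: L1funD => //; exact: L1funZ.
  have L1 : \forall y \ae mu', _ := markov_linear M (t ^+ 2) ip ide.
  have L2 : \forall y \ae mu', _ := markov_linear M (- 2 * t) id Jd.
  have P : \forall y \ae mu', 0 <= Psi (fun x => t ^+ 2 * p x + ((- 2 * t) * d x + e x)) y.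
    apply: markov_ge0 => //; move: p0 pd; apply: filterS2 => x p0 pd.
    (* Where [p] vanishes so does [d], hence all three terms; elsewhere their sum is
       [(d - t p)^2 / p]. *)
    have [px0|pn0] := eqVneq (p x) 0; first by rewrite /e pd// px0 expr0n/= !mul0r !mulr0 !addr0.
    rewrite (_ : _ + _ = (d x - t * p x) ^+ 2 / p x) ?divr_ge0 ?sqr_ge0// /e.
    by field.
  move: L1 L2 P; apply: filterS3 => y -> ->; rewrite /e; lra.
have {}quad : \forall y \ae mu', forall t : rat,
    0 <= Psi e y - 2 * ratr t * Psi d y + ratr t ^+ 2 * Psi p y.
  (* The rationals are enumerated by [unpickle], so that the quantifier over t passes inside the
     almost-everywhere statement. *)
  have : \forall y \ae mu', forall n, if @unpickle rat n is Some t then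
     0 <= Psi e y - 2 * ratr t * Psi d y + ratr t ^+ 2 * Psi p y else true.
    apply: ae_foralln => n; case: (unpickle n) => [t|]; last exact: nearW.
    exact: quad.
  by apply: filterS => y H t; have := H (pickle t); rewrite pickleK.
have {}quad : \forall y \ae mu', (Psi p y = 0 -> Psi d y = 0) /\ Psi d y ^+ 2 / Psi p y <= Psi e y.
  have [_ P0 _] := Dp.
  by move: quad P0; apply: filterS2 => y H P0; exact: quadratic_bound.
have [_ P0 _] := Dp.
have iPd := markov_L1 M id; have iPp := markov_L1 M ip; have iPe := markov_L1 M Jd.
have mJ : measurable_fun setT (fun y => Psi d y ^+ 2 / Psi p y).
  by apply: measurable_div; [apply: measurable_funX|]; exact: L1fun_measurable.
apply: local_dataI => //.
- by rewrite markov_integral// tangent_integral.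
- by apply: filterS quad => y [].
apply: ge0_L1fun => //.
  by apply: filterS P0 => x ?; rewrite divr_ge0// sqr_ge0.
apply: le_lt_trans (integrable_lty measurableT iPe).
apply: ae_ge0_le_integralr => //.
- exact: L1fun_measurable.
- by apply: filterS P0 => x Px; rewrite divr_ge0// sqr_ge0.
- by apply: filterS quad => y [].
Qed.

End markov_local_data.

(** * Markov maps given by kernels *)

Section transition_kernel.
Context d1 d2 d3 (X : measurableType d1) (Y : measurableType d2) (A : measurableType d3).
Variables (R : realType) (m : {sigma_finite_measure set A -> \bar R}).
Variables (k : X * A -> R) (th : X * A -> Y).
Hypothesis mk : measurable_fun setT k.
Hypothesis k0 : forall z, 0 <= k z.
Hypothesis k1 : forall x, (\int[m]_a (k (x, a))%:E = 1)%E.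
Hypothesis mth : measurable_fun setT th.

Let K (x : X) (B : set Y) : \bar R :=
  (\int[m]_(a in (fun a => th (x, a)) @^-1` B) (k (x, a))%:E)%E.

Let mkx x : measurable_fun setT (fun a => k (x, a)).
Proof. exact: measurableT_comp. Qed.

Let mthx x : measurable_fun setT (fun a => th (x, a)).
Proof. exact: measurableT_comp. Qed.

Let mpre x B : measurable B -> measurable ((fun a => th (x, a)) @^-1` B).
Proof. by move=> mB; rewrite -[X in measurable X]setTI; exact: mthx. Qed.

Let ik x : m.-integrable setT (EFin \o (fun a => k (x, a))).
Proof.
apply/integrableP; split; first exact/measurable_EFinP.
rewrite (eq_integral (fun a => (k (x, a))%:E)) ?k1 ?ltry// => a _ /=.
by rewrite ger0_norm.
Qed.

Let K0 x : K x set0 = 0%E.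
Proof. by rewrite /K preimage_set0 integral_set0. Qed.

Let K_ge0 x B : (0 <= K x B)%E.
Proof. by apply: integral_ge0 => a _; rewrite lee_fin. Qed.

Let K_sigma x : semi_sigma_additive (K x).
Proof.
move=> /= F mF tF mUF; rewrite /K preimage_bigcup integral_bigcup//; last 3 first.
- apply/trivIsetP => i j _ _ ij; rewrite -preimage_setI.
  by move/trivIsetP : tF => /(_ i j I I ij) ->; rewrite preimage_set0.
- by move=> n; exact: mpre.
- apply: (integrableS _ _ (subsetT _)) => //; last exact: ik.
  by apply: bigcup_measurable => n _; exact: mpre.
apply: is_cvg_ereal_nneg_natsum_cond => n _ _.
by apply: integral_ge0 => /= a ?; rewrite lee_fin.
Qed.

HB.instance Definition _ x := isMeasure.Build _ _ _ (K x) (K0 x) (K_ge0 x) (@K_sigma x).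

Let KE x B : measurable B -> K x B = (\int[m]_a (k (x, a) * \1_B (th (x, a)))%:E)%E.
Proof.
by move=> mB; rewrite /K integral_indicr; [apply: eq_integral|exact: mpre].
Qed.

Let K_measurable U : measurable U -> measurable_fun setT (K ^~ U).
Proof.
move=> mU; rewrite (_ : K ^~ U = fun x => (\int[m]_a (k (x, a) * \1_U (th (x, a)))%:E)%E).
  apply: (measurable_fun_fubini_tonelli_F (fun z => (k z * \1_U (th z))%:E)).
    apply/measurable_EFinP/measurable_funM => //.
    by apply: measurableT_comp => //; exact: measurable_indic.
  by move=> z; rewrite lee_fin mulr_ge0.
by apply/funext => x; exact: KE.
Qed.

Let KM (x : X) : {measure set Y -> \bar R} := K x.

HB.instance Definition _ := isKernel.Build _ _ _ _ _ KM K_measurable.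

Let K_prob x : KM x setT = 1%E.
Proof. by rewrite /KM /= /K preimage_setT k1. Qed.

HB.instance Definition _ := Kernel_isProbability.Build _ _ _ _ _ KM K_prob.

(** This is the law of [th (x, a)] when [a] is drawn with density [k (x, .)]. Taking for [th] the
    second projection gives kernels with a density; [th (y, x) = y + W x] gives convolution with the
    law of [W], whose kernel may have atoms. *)
Lemma transition_kernel : exists K : R.-pker X ~> Y, forall x B, measurable B ->
  K x B = (\int[m]_a (k (x, a) * \1_B (th (x, a)))%:E)%E.
Proof. by exists KM => x B mB; rewrite -KE. Qed.

End transition_kernel.

Section marginals.
Context d1 d2 (T1 : measurableType d1) (T2 : measurableType d2) (R : realType).
Variable m1 : {sigma_finite_measure set T1 -> \bar R}.
Variable m2 : {sigma_finite_measure set T2 -> \bar R}.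
Variable G : T1 * T2 -> R.
Hypothesis iG : (m1 \x m2)%E.-integrable setT (EFin \o G).

Let mG : measurable_fun setT G.
Proof. apply/measurable_EFinP. exact: (measurable_int _ iG). Qed.

Let mfG : measurable_fun setT (fun y => (\int[m1]_x (G (x, y))%:E)%E).
Proof. exact: (measurable_fubini_G iG). Qed.

Let aeG : \forall y \ae m2, (\int[m1]_x (G (x, y))%:E)%E = (\int[m1]_x G (x, y))%:E.
Proof.
apply: filterS (ae_integrable2 iG) => y yi; rewrite fineK//; exact: integrable_fin_num.
Qed.

Let mmarg : measurable_fun setT (fun y => \int[m1]_x G (x, y)).
Proof. by apply: measurableT_comp mfG; exact: fine_measurable. Qed.

Lemma integrable_marginal :
  m2.-integrable setT (EFin \o (fun y => \int[m1]_x G (x, y))).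
Proof.
apply/integrableP; split; first exact/measurable_EFinP.
have mEG : measurable_fun setT (EFin \o G) by exact/measurable_EFinP.
have := (integrable21ltyP m1 m2 mEG).1 iG; apply: le_lt_trans.
rewrite (@ae_eq_integral _ _ _ m2 setT (fun y => `|\int[m1]_x (G (x, y))%:E|)%E
   (fun y => `|(\int[m1]_x G (x, y))%:E|)%E)//; last 3 first.
- by apply: measurableT_comp => //; exact/measurable_EFinP.
- exact: measurableT_comp.
- by apply: filterS aeG => y -> _.
apply: ge0_le_integral => //.
- exact: measurableT_comp.
- apply: (measurable_fun_fubini_tonelli_G (fun z => `|(G z)%:E|%E)) => //.
  exact: measurableT_comp.
- move=> y _; apply: le_abse_integral => //.
  by apply/measurable_EFinP; exact: measurableT_comp.
Qed.

(** Fubini, except that the marginal is real-valued: it is the finite part of an extended integral,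
    and agrees with it only for almost every [y], by [aeG]. *)
Lemma integral_marginal B : measurable B ->
  (\int[m2]_(y in B) (\int[m1]_x G (x, y))%:E
   = \int[m1]_x \int[m2]_(y in B) (G (x, y))%:E)%E.
Proof.
move=> mB.
pose G' z := G z * \1_B z.2.
have iG' : (m1 \x m2)%E.-integrable setT (EFin \o G').
  apply: le_integrable iG => //.
    apply/measurable_EFinP/measurable_funM => //.
    by apply: measurableT_comp => //; exact: measurable_indic.
  by move=> z _; rewrite lee_fin normrM ler_piMr// indicE; case: (_ \in _); rewrite ?normr1 ?normr0.
rewrite integral_indicr// (eq_integral (fun x => \int[m2]_y (G' (x, y))%:E)%E); last first.
  by move=> x _; rewrite integral_indicr.
rewrite (Fubini iG'); apply: ae_eq_integral => //.
- apply/measurable_EFinP/measurable_funM => //; exact: measurable_indic.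
- exact: (measurable_fubini_G iG').
apply: filterS2 aeG (ae_integrable2 iG) => y Gy yi _.
rewrite EFinM -Gy /G'/=; under [RHS]eq_integral do rewrite EFinM.
by rewrite integralZr.
Qed.

End marginals.

Section density_map.
Variables (R : realType) (S S' : sample_space).
Local Notation mu := (refm R S).
Local Notation mu' := (refm R S').
Variable k : carrier R S * carrier R S' -> R.
Hypothesis mk : measurable_fun setT k.
Hypothesis k0 : forall z, 0 <= k z.
Hypothesis k1 : forall x, (\int[mu']_y (k (x, y))%:E = 1)%E.

Definition density_map (f : carrier R S -> R) (y : carrier R S') : R :=
  \int[mu]_x (f x * k (x, y)).

Lemma markov_density_map : markov_map density_map.
Proof.
apply: markov_mapI.
have [K KE] := transition_kernel mk k0 k1 (@measurable_snd _ _ _ _).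
exists K => f fi.
have mf := L1fun_measurable fi.
have mG : measurable_fun setT (EFin \o (fun z => f z.1 * k z)).
  apply/measurable_EFinP/measurable_funM => //; exact: measurableT_comp.
have iG : (mu \x mu')%E.-integrable setT (EFin \o (fun z => f z.1 * k z)).
  apply: (integrable12ltyP _ _ mG).2 => /=.
  rewrite (eq_integral (fun x => `|(f x)%:E|)%E); first by case/integrableP : fi.
  move=> x _; under eq_integral do rewrite normrM (ger0_norm (k0 _)) EFinM.
  rewrite ge0_integralZl// ?k1 ?mule1//.
    by apply/measurable_EFinP; exact: measurableT_comp.
  by move=> y _; rewrite lee_fin.
split; first exact: integrable_marginal iG.
move=> B mB; rewrite (integral_marginal iG mB).
apply: eq_integral => x _; rewrite KE// integral_indicr// /=.
rewrite -integralZl//.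
  by apply: eq_integral => y _; rewrite -EFinM mulrA.
have k1' := k1 x.
apply/integrableP; split.
  apply/measurable_EFinP/measurable_funM; first exact: measurableT_comp.
  exact: measurable_indic.
apply: (@le_lt_trans _ _ 1%E); last exact: ltry.
rewrite -k1'; apply: ge0_le_integral => //.
- apply: measurableT_comp => //; apply/measurable_EFinP/measurable_funM; first exact: measurableT_comp.
  exact: measurable_indic.
- by apply/measurable_EFinP; exact: measurableT_comp.
- move=> y _; rewrite /= lee_fin normrM (ger0_norm (k0 _)) ler_piMr// indicE.
  by case: (_ \in _); rewrite ?normr1 ?normr0.
Qed.

End density_map.

Section convolution_map.
Variables (R : realType) (S : sample_space).
Local Notation mu := (refm R S).
Local Notation leb := (@lebesgue_measure R).
Local Notation RR := (carrier R SReal).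
Variables (P W : carrier R S -> R).
Hypothesis iP : L1fun S P.
Hypothesis P0 : forall x, 0 <= P x.
Hypothesis P1 : (\int[mu]_x (P x)%:E = 1)%E.
Hypothesis mW : measurable_fun setT W.

(** The density of [W x + z] for independent [x] and [z] with densities [P] and [f]. It is read in
    two ways: as a Markov map in [f], which adds an independent copy of [W], and, for [f] the normal
    density, as the image of [P] under the channel that adds noise to [W]. *)
Definition convolution_map (f : RR -> R) (y : RR) : R := \int[mu]_x (P x * f (y - W x)).

Let mP : measurable_fun setT P. Proof. exact: L1fun_measurable. Qed.

Lemma measurable_shifted (f : RR -> R) : measurable_fun setT f ->
  measurable_fun setT (fun z : carrier R S * RR => f (z.2 - W z.1)).
Proof.
move=> mf; apply: (measurableT_comp mf).
apply: measurable_funB; first exact: measurable_snd.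
exact: measurableT_comp.
Qed.

Lemma integrable_convolution (f : RR -> R) : L1fun SReal f ->
  (mu \x leb)%E.-integrable setT (EFin \o (fun z => P z.1 * f (z.2 - W z.1))).
Proof.
move=> fi; have mf := L1fun_measurable fi.
have mG : measurable_fun setT (EFin \o (fun z => P z.1 * f (z.2 - W z.1))).
  apply/measurable_EFinP/measurable_funM; last exact: measurable_shifted.
  exact: measurableT_comp.
apply: (integrable12ltyP mu leb mG).2 => /=.
rewrite (eq_integral (fun x => (P x)%:E * \int[leb]_y `|(f y)%:E|)%E).
  rewrite ge0_integralZr//; last 3 first.
  - exact/measurable_EFinP.
  - by move=> x _; rewrite lee_fin.
  - exact: integral_ge0.
  by rewrite P1 mul1e; case/integrableP : fi.
move=> x _; under eq_integral do rewrite normrM (ger0_norm (P0 _)) EFinM.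
rewrite ge0_integralZl//; last 2 first.
- apply/measurable_EFinP; apply: measurableT_comp => //; apply: (measurableT_comp mf).
  exact: measurable_translation.
- by rewrite lee_fin.
congr (_ * _)%E.
apply: (@ge0_integral_translation R (W x) (fun y => `|(f y)%:E|%E)) => //.
by apply: measurableT_comp => //; exact/measurable_EFinP.
Qed.

(** Translating the inner integral by [W x] moves the dependence on [x] from [f] to the indicator of
    [B]; exchanging the integrals then shows the kernel. *)
Lemma markov_convolution_map : markov_map convolution_map.
Proof.
apply: markov_mapI.
pose k (z : RR * carrier R S) := P z.2.
pose th (z : RR * carrier R S) : RR := z.1 + W z.2.
have mk : measurable_fun setT k by exact: measurableT_comp.
have mth : measurable_fun setT th.
  by apply: measurable_funD; [exact: measurable_fst|exact: measurableT_comp].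
have [K KE] := transition_kernel mk (fun z => P0 z.2) (fun=> P1) mth.
exists K => f fi.
have mf := L1fun_measurable fi.
have iG := integrable_convolution fi.
split; first exact: integrable_marginal iG.
move=> B mB; rewrite (integral_marginal iG mB).
pose G2 (z : carrier R S * RR) := P z.1 * f z.2 * \1_B (z.2 + W z.1).
have mG2 : measurable_fun setT G2.
  apply: measurable_funM.
    by apply: measurable_funM; apply: measurableT_comp.
  apply: measurableT_comp; first exact: measurable_indic.
  by apply: measurable_funD; [exact: measurable_snd|exact: measurableT_comp].
have iG2 : (mu \x leb)%E.-integrable setT (EFin \o G2).
  apply: le_integrable (integrable_tensor iP fi) => //; first exact/measurable_EFinP.
  move=> z _; rewrite /G2 /= lee_fin normrM ler_piMr// indicE.
  by case: (_ \in _); rewrite ?normr1 ?normr0.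
transitivity (\int[mu]_x \int[leb]_z (G2 (x, z))%:E)%E.
  apply: eq_integral => x _; rewrite integral_indicr//.
  rewrite -(@integral_translation R (W x) (fun z => (G2 (x, z))%:E)); last first.
    by apply/measurable_EFinP; exact: measurableT_comp.
  by apply: eq_integral => y _; rewrite /G2/= subrK.
rewrite (Fubini iG2); apply: eq_integral => z _; rewrite KE//.
rewrite -integralZl//.
  by apply: eq_integral => x _; rewrite -EFinM /G2 /k /th /= mulrA [f z * _]mulrC.
apply: le_integrable iP => //.
  apply/measurable_EFinP; apply: measurable_funM => //.
  apply: measurableT_comp; first exact: measurable_indic.
  by apply: measurable_funD.
move=> x _; rewrite /= lee_fin normrM ler_piMr// indicE.
by case: (_ \in _); rewrite ?normr1 ?normr0.
Qed.

End convolution_map.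

(** * The standard normal density *)

Section taylor.
Variable R : realType.

Section pointwise_rules.
Variables (f g : R -> R) (x a b : R).
Hypotheses (fa : is_derive x 1 f a) (gb : is_derive x 1 g b).

Lemma is_derive1D : is_derive x 1 (fun y => f y + g y) (a + b).
Proof. exact: is_deriveD. Qed.

Lemma is_derive1B : is_derive x 1 (fun y => f y - g y) (a - b).
Proof. exact: is_deriveB. Qed.

Lemma is_derive1M : is_derive x 1 (fun y => f y * g y) (f x * b + g x * a).
Proof. exact: is_deriveM. Qed.

End pointwise_rules.

Lemma is_derive1_id (x : R) : is_derive x 1 (fun y : R => y) 1.
Proof. exact: is_derive_id. Qed.

Lemma is_derive1_cst (k x : R) : is_derive x 1 (fun y : R => k) 0.
Proof. exact: is_derive_cst. Qed.

(** The mean value theorem between 0 and [x]. The constant is not divided by k + 1, as only the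
    order of growth matters. *)
Lemma power_growth (G dG : R -> R) (C : R) (k : nat) : G 0 = 0 ->
  (forall x : R, is_derive x 1 G (dG x)) -> (forall x, `|dG x| <= C * `|x| ^+ k) ->
  forall x, `|G x| <= C * `|x| ^+ k.+1.
Proof.
move=> G0 GD Gk x.
have C0 : 0 <= C by have := le_trans (normr_ge0 _) (Gk 1); rewrite normr1 expr1n mulr1.
have cG : continuous G.
  by move=> y; apply: differentiable_continuous; apply/derivable1_diffP; have [] := GD y.
have cW (a b : R) : {within `[a, b], continuous G} by exact: continuous_subspaceT.
have [xneg|xpos] := ltP x 0.
  have [z] := MVT_segment (ltW xneg) (fun y _ => GD y) (cW _ _).
  rewrite in_itv/= G0 !sub0r => /andP[xz z0] E.
  rewrite -normrN E normrM normrN exprSr mulrA ler_wpM2r//.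
  rewrite (le_trans (Gk z))// ler_wpM2l// lerXn2r ?nnegrE//.
  by rewrite ler0_norm// ler0_norm ?(ltW xneg)// lerN2.
have [z] := MVT_segment xpos (fun y _ => GD y) (cW _ _).
rewrite in_itv/= G0 !subr0 => /andP[z0 xz] E.
rewrite E normrM exprSr mulrA ler_wpM2r//.
rewrite (le_trans (Gk z))// ler_wpM2l// lerXn2r ?nnegrE//.
by rewrite ger0_norm// ger0_norm.
Qed.

(** Three applications of [power_growth], to the second, first and zeroth order remainders in turn;
    each one is the derivative of the next. *)
Lemma taylor2 (f f1 f2 f3 : R -> R) (M : R) :
  (forall x : R, is_derive x 1 f (f1 x)) ->
  (forall x : R, is_derive x 1 f1 (f2 x)) ->
  (forall x : R, is_derive x 1 f2 (f3 x)) ->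
  (forall x, `|f3 x| <= M) ->
  forall y h, `|f (y + h) - f y - h * f1 y - h ^+ 2 / 2 * f2 y| <= M * `|h| ^+ 3.
Proof.
move=> D1 D2 D3 fM y h.
have shiftD (u v : R -> R) : (forall x : R, is_derive x 1 u (v x)) ->
    forall x : R, is_derive x 1 (fun x => u (y + x)) (v (y + x)).
  move=> uv x; have uvx := uv (y + x).
  have H : is_derive x 1 (fun x => y + x) 1.
    by apply: (is_derive_eq (is_derive1D (is_derive1_cst y x) (is_derive1_id x))); rewrite add0r.
  by have := is_derive1_comp uvx H; rewrite mulr1.
have E1 := shiftD _ _ D1; have E2 := shiftD _ _ D2; have E3 := shiftD _ _ D3.
have B2 x : `|f2 (y + x) - f2 y| <= M * `|x| ^+ 1.
  apply: (@power_growth (fun x => f2 (y + x) - f2 y) (fun x => f3 (y + x)) M 0).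
  - by rewrite addr0 subrr.
  - move=> t; apply: (is_derive_eq (is_derive1B (E3 t) (is_derive1_cst (f2 y) t))); ring.
  - by move=> t; rewrite expr0 mulr1.
have B1 x : `|f1 (y + x) - f1 y - x * f2 y| <= M * `|x| ^+ 2.
  apply: (@power_growth (fun x => f1 (y + x) - f1 y - x * f2 y) (fun x => f2 (y + x) - f2 y) M 1) => //.
  - by rewrite addr0 subrr mul0r subr0.
  - move=> t; apply: (is_derive_eq (is_derive1B (is_derive1B (E2 t) (is_derive1_cst (f1 y) t))
      (is_derive1M (is_derive1_id t) (is_derive1_cst (f2 y) t)))); ring.
apply: (@power_growth (fun h => f (y + h) - f y - h * f1 y - h ^+ 2 / 2 * f2 y)
  (fun x => f1 (y + x) - f1 y - x * f2 y) M 2) => //.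
- by rewrite addr0 subrr mul0r expr0n/= !mul0r !subr0.
- move=> t.
  have D2t : is_derive t 1 (fun h => h ^+ 2 / 2 : R) t.
    apply: (is_derive_eq (is_derive1M (is_derive1M (is_derive1_id t) (is_derive1_id t))
      (is_derive1_cst 2^-1 t))); by field.
  apply: (is_derive_eq (is_derive1B (is_derive1B (is_derive1B (E1 t) (is_derive1_cst (f y) t))
      (is_derive1M (is_derive1_id t) (is_derive1_cst (f1 y) t)))
      (is_derive1M D2t (is_derive1_cst (f2 y) t)))); by field.
Qed.

End taylor.

Section gaussian.
Variable R : realType.
Local Notation leb := (@lebesgue_measure R).
Local Notation phi := (@normal_pdf R 0 1).
Local Notation c := (@normal_peak R 1).

Lemma phiE x : phi x = c * expR (- (x ^+ 2 / 2)).
Proof. by rewrite normal_pdfE ?oner_neq0// /normal_fun subr0 expr1n mulr2n mulNr. Qed.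

Lemma phi_gt0 x : 0 < phi x.
Proof. by rewrite phiE mulr_gt0 ?expR_gt0// normal_peak_gt0 ?oner_neq0. Qed.

Lemma measurable_phi : measurable_fun setT phi.
Proof. exact: measurable_normal_pdf. Qed.

Lemma normal_peak1_le1 : c <= 1.
Proof.
rewrite /normal_peak invf_le1 ?sqrtr_gt0; last first.
  by rewrite expr1n mul1r mulrn_wgt0// pi_gt0.
rewrite -[leLHS]sqrtr1 ler_wsqrtr// expr1n mul1r mulr2n.
have := @pi_ge2 R; lra.
Qed.

(** Since [exp (x^2 / 2)] is the square of [exp (x^2 / 4) >= 1 + x^2 / 4], the normal density
    absorbs a polynomial of degree four; its peak is at most 1. *)
Lemma poly_phi_le (P : R -> R) (C : R) : (forall x, `|P x| <= C * (1 + x ^+ 2 / 4) ^+ 2) ->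
  forall x, `|P x * phi x| <= C.
Proof.
move=> PC x.
have e1 : (1 + x ^+ 2 / 4) ^+ 2 <= expR (x ^+ 2 / 2).
  have -> : x ^+ 2 / 2 = x ^+ 2 / 4 + x ^+ 2 / 4 by field.
  rewrite expRD expr2; have := sqr_ge0 x => x0.
  by apply: ler_pM; rewrite ?expR_ge1Dx//; lra.
have C0 : 0 <= C.
  by have := le_trans (normr_ge0 _) (PC 0); rewrite expr0n/= mul0r addr0 expr1n mulr1.
rewrite normrM (ger0_norm (ltW (phi_gt0 x))) phiE expRN.
rewrite mulrA ler_pdivrMr ?expR_gt0//.
apply: (@le_trans _ _ `|P x|); first by rewrite ler_piMr// normal_peak1_le1.
by rewrite (le_trans (PC x))// ler_wpM2l.
Qed.

Lemma phi_le1 x : `|phi x| <= 1.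
Proof.
rewrite -[phi x]mul1r; apply: (@poly_phi_le (fun=> 1)) => y.
by rewrite normr1 mul1r; have := sqr_ge0 (y ^+ 2); have := sqr_ge0 y; nra.
Qed.

Lemma x_phi_le x : `|x * phi x| <= 1.
Proof.
apply: (@poly_phi_le id) => y; rewrite mul1r ler_norml.
by apply/andP; split; have := sqr_ge0 (y - 1); have := sqr_ge0 (y + 1); have := sqr_ge0 (y ^+ 2); nra.
Qed.

Lemma is_derive_phi (x : R) : is_derive x 1 phi (- x * phi x).
Proof.
have -> : phi = (fun x => c * expR (- (x ^+ 2 / 2))) by apply/funext => y; exact: phiE.
have H : is_derive x 1 (fun x : R => - (x ^+ 2 / 2)) (- x).
  have -> : (fun x : R => - (x ^+ 2 / 2)) = (fun x => x * x * (- 2^-1)).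
    by apply/funext => y; ring.
  apply: (is_derive_eq (is_derive1M (is_derive1M (is_derive1_id x) (is_derive1_id x))
      (is_derive1_cst (- 2^-1) x))); by field.
have H2 := is_derive1_comp (is_derive_expR _) H.
apply: (is_derive_eq (is_derive1M (is_derive1_cst c x) H2)); ring.
Qed.

Let phi1 (x : R) := - x * phi x.
Let phi2 (x : R) := (x ^+ 2 - 1) * phi x.
Let phi3 (x : R) := (3 * x - x ^+ 3) * phi x.

Lemma phi_taylor : exists f1 f2 : R -> R, exists M : R,
  [/\ measurable_fun setT f1, measurable_fun setT f2,
      forall x, `|f1 x| <= M, forall x, `|f2 x| <= M &
      forall y h, `|phi (y + h) - phi y - h * f1 y - h ^+ 2 / 2 * f2 y| <= M * `|h| ^+ 3].
Proof.
have D1 := is_derive_phi.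
(* The three [Let] functions are the first derivatives of [phi]. As
   [16 (1 + x^2 / 4)^2 = (4 + x^2)^2], the constant 16 dominates their polynomial factors. *)
exists phi1, phi2, 16; split.
- by apply: measurable_funM; [exact: measurable_funN|exact: measurable_phi].
- by apply: measurable_funM; [apply: measurable_funB|exact: measurable_phi].
- by move=> x; rewrite /phi1 mulNr normrN (le_trans (x_phi_le x))// ler1n.
- apply: poly_phi_le => x; rewrite ler_norml.
  by apply/andP; split; have := sqr_ge0 (x ^+ 2); have := sqr_ge0 x; nra.
apply: (@taylor2 R phi phi1 phi2 phi3) => //.
- move=> x; have -> : phi1 = (fun x => (0 - x) * phi x) by apply/funext => y; rewrite /phi1 sub0r.
  apply: (is_derive_eq (is_derive1M (is_derive1B (is_derive1_cst 0 x) (is_derive1_id x)) (D1 x))).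
  by rewrite /phi2; ring.
- move=> x; have -> : phi2 = (fun x => (x * x - 1) * phi x) by apply/funext => y; rewrite /phi2 expr2.
  apply: (is_derive_eq (is_derive1M (is_derive1B (is_derive1M (is_derive1_id x) (is_derive1_id x))
    (is_derive1_cst 1 x)) (D1 x))).
  by rewrite /phi3; ring.
apply: poly_phi_le => x.
have -> : 3 * x - x ^+ 3 = x * (3 - x ^+ 2) by ring.
rewrite normrM.
have h1 : `|x| <= (1 + x ^+ 2) / 2.
  rewrite ler_norml; apply/andP; split; have := sqr_ge0 (x - 1); have := sqr_ge0 (x + 1); nra.
have h2 : `|3 - x ^+ 2| <= 3 + x ^+ 2.
  by rewrite ler_norml; apply/andP; split; have := sqr_ge0 x; lra.
apply: (@le_trans _ _ ((1 + x ^+ 2) / 2 * (3 + x ^+ 2))).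
  by apply: ler_pM.
by have := sqr_ge0 (x ^+ 2); have := sqr_ge0 x; nra.
Qed.

End gaussian.

Section gaussian_moments.
Variable R : realType.
Local Notation leb := (@lebesgue_measure R).
Local Notation phi := (@normal_pdf R 0 1).
Local Notation c := (@normal_peak R 1).

Lemma integral_oppr (f : R -> \bar R) : measurable_fun [set: R] f ->
  (\int[leb]_y f (- y)%R = \int[leb]_y f y)%E.
Proof.
have ge0 (h : R -> \bar R) : measurable_fun [set: R] h -> (forall x, (0 <= h x)%E) ->
    (\int[leb]_y h (- y)%R = \int[leb]_y h y)%E.
  move=> mh h0.
  have mN : measurable_fun setT (fun y : measurableTypeR R => - y : measurableTypeR R).
    exact: measurable_funN.
  transitivity (\int[pushforward leb (fun y : measurableTypeR R => - y : measurableTypeR R)%R]_y h y)%E.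
    by rewrite (ge0_integral_pushforward mN).
  apply: eq_measure_integral.
  by move=> A mA _; exact: lebesgue_measureN.
move=> mf; rewrite integralE [RHS]integralE.
have P : (\int[leb]_y (f^\+ (- y)%R) = \int[leb]_y f^\+ y)%E.
  by apply: ge0 => //; exact: measurable_funepos.
have N : (\int[leb]_y (f^\- (- y)%R) = \int[leb]_y f^\- y)%E.
  by apply: ge0 => //; exact: measurable_funeneg.
by rewrite -P -N funepos_comp funeneg_comp.
Qed.

Lemma phi_ge0 x : 0 <= phi x.
Proof. by rewrite ltW// phi_gt0. Qed.

Lemma phiN x : phi (- x) = phi x.
Proof. by rewrite !phiE sqrrN. Qed.

Lemma continuous_phi : continuous phi.
Proof. by apply: continuous_normal_pdf; exact: oner_neq0. Qed.

Lemma phi_cvg0 : phi x @[x --> +oo%R] --> (0 : R).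
Proof.
apply/cvgrPdist_lt => e e0; near=> x.
have x0 : 0 < x by near: x; exact: nbhs_pinfty_gt.
have xe : e^-1 < x by near: x; apply: nbhs_pinfty_gt; exact: num_real.
rewrite sub0r normrN.
have := x_phi_le x; rewrite normrM (gtr0_norm x0) mulrC -ler_pdivlMr// div1r => /le_lt_trans; apply.
by rewrite -[ltRHS]invrK ltf_pV2// posrE invr_gt0.
Unshelve. all: by end_near. Qed.

Lemma integral_x_phi_tail (t : R) : 0 <= t ->
  (\int[leb]_(x in `[t, +oo[) (x * phi x)%:E = (phi t)%:E)%E.
Proof.
move=> t0.
have D (x : R) : is_derive x 1 (fun x => - phi x) (x * phi x).
  by have := is_deriveN (is_derive_phi x); rewrite mulNr opprK.
rewrite (@ge0_continuous_FTC2y _ _ (fun x => - phi x) _ 0).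
- by rewrite EFinN oppeK add0e.
- by move=> x tx; apply: mulr_ge0; [exact: le_trans tx|exact: phi_ge0].
- apply: continuous_subspaceT => x; apply: cvgM; first exact: cvg_id.
  exact: continuous_phi.
- by have := cvgN phi_cvg0; rewrite oppr0; exact.
- by move=> x _; have [] := D x.
- apply: cvg_at_right_filter; apply: cvgN; exact: continuous_phi.
- by move=> x _; have [? <-] := D x; rewrite derive1E.
Qed.

(* Tonelli: both sides are the integral of x * phi x over 0 <= t <= x, since
   the inner integral over x >= t is phi t. *)
Lemma integral_sqr_phi_half :
  (\int[leb]_(x in [set x | (0 <= x)%R]) (x ^+ 2 * phi x)%:E =
   \int[leb]_(t in [set x | (0 <= x)%R]) (phi t)%:E)%E.
Proof.
have mA : measurable [set x : R | 0 <= x] by rewrite -set_itvcy.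
pose E := [set z : measurableTypeR R * measurableTypeR R | 0 <= z.2] `&`
  [set z : measurableTypeR R * measurableTypeR R| z.2 <= z.1].
have mE : measurable E.
  have mcmp (f g : measurableTypeR R * measurableTypeR R -> R) :
      measurable_fun setT f -> measurable_fun setT g -> measurable [set z | f z <= g z].
    move=> mf mg.
    rewrite (_ : [set z | f z <= g z] = setT `&` (fun z => g z - f z) @^-1` `[0, +oo[%classic).
      have mgf := measurable_funB mg mf.
      by apply: mgf => //; exact: measurable_itv.
    by apply/seteqP; split => z /=; rewrite in_itv/= andbT subr_ge0 => // -[].
  apply: measurableI.
    by apply: (mcmp (fun=> 0) snd) => //; exact: measurable_snd.
  by apply: (mcmp snd fst); [exact: measurable_snd|exact: measurable_fst].
pose H (z : measurableTypeR R * measurableTypeR R) : R := z.1 * phi z.1 * \1_E z.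
have mH : measurable_fun setT (EFin \o H).
  apply/measurable_EFinP; apply: measurable_funM; last exact: measurable_indic.
  apply: measurable_funM; first exact: measurable_fst.
  by apply: measurableT_comp; [exact: measurable_phi|exact: measurable_fst].
have H0 z : (0%R <= (EFin \o H) z)%E.
  rewrite lee_fin /H indicE; case: (boolP (z \in E)); last by rewrite mulr0.
  rewrite inE => -[/= z2 z1]; rewrite mulr1; apply: mulr_ge0; last exact: phi_ge0.
  exact: le_trans z1.
have := fubini_tonelli (m1 := leb) (m2 := leb) (EFin \o H) mH H0.
move=> FT; rewrite [LHS]integral_mkcond [RHS]integral_mkcond.
transitivity (\int[leb]_x \int[leb]_y (EFin \o H) (x, y))%E.
  apply: eq_integral => x _; rewrite /patch; case: ifPn => x0.
    rewrite inE/= in x0.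
    transitivity (\int[leb]_t ((x * phi x) * \1_`[0%R, x] t)%:E)%E; last first.
      apply: eq_integral => t _; rewrite /= /H/=; congr (_ * _)%:E; rewrite !indicE; congr (_%:R); congr nat_of_bool.
      by apply/idP/idP; rewrite !inE /E/= in_itv/=; [move=> /andP[]|move=> [-> ->]].
    rewrite -integral_indicr//.
    rewrite integral_cst//= lebesgue_measure_itv/= lte_fin.
    case: ltP => [_|x0']; first by rewrite sube0 -EFinM expr2 mulrAC.
    by have -> : x = 0 by [apply/le_anti/andP]; rewrite mule0 expr0n/= mul0r.
  apply/esym; apply: integral0_eq => t _; rewrite /= /H indicE.
  rewrite (_ : (x, t) \in E = false) ?mulr0//.
  apply/negbTE/negP; rewrite inE => -[/= t0 tx].
  by move: x0; rewrite notin_setE/=; apply; exact: le_trans tx.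
rewrite FT; apply: eq_integral => t _; rewrite /patch; case: ifPn => t0.
  rewrite inE/= in t0; rewrite -integral_x_phi_tail//.
  rewrite [RHS]integral_mkcond; apply: eq_integral => x _.
  rewrite /= /H/= /patch indicE.
  have -> : ((x, t) \in E) = (x \in `[t, +oo[%classic).
    by apply/idP/idP; rewrite !inE /E/= in_itv/= andbT; [case|move=> tx; split].
  by case: (_ \in _); rewrite ?mulr1 ?mulr0.
apply: integral0_eq => x _; rewrite /= /H indicE.
rewrite (_ : (x, t) \in E = false) ?mulr0//.
apply/negbTE/negP; rewrite inE => -[/= t0' tx].
by move: t0; rewrite notin_setE/=.
Qed.

(** Both integrands of the half-line identity are even, so it doubles to the whole line, where [phi]
    has mass 1. *)
Lemma integral_sqr_phi : (\int[leb]_x (x ^+ 2 * phi x)%:E = 1)%E.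
Proof.
rewrite (@ge0_symfun_integralT R (fun x => x ^+ 2 * phi x)).
- rewrite integral_sqr_phi_half -(@ge0_symfun_integralT R phi).
  + by rewrite integral_normal_pdf// oner_neq0.
  + by move=> x; rewrite ltW// phi_gt0.
  + exact: continuous_phi.
  + by move=> x /=; rewrite phiN.
- by move=> x; rewrite mulr_ge0 ?sqr_ge0// ltW// phi_gt0.
- move=> x; apply: cvgM; last exact: continuous_phi.
  exact: exprn_continuous.
- by move=> x /=; rewrite phiN sqrrN.
Qed.

Lemma integrable_phi : leb.-integrable setT (EFin \o phi).
Proof. by apply: integrable_normal_pdf; exact: oner_neq0. Qed.

Lemma integral_phi : (\int[leb]_x (phi x)%:E = 1)%E.
Proof. by apply: integral_normal_pdf; exact: oner_neq0. Qed.

Lemma integrable_x4_phi : leb.-integrable setT (EFin \o (fun x => x ^+ 4 * phi x)).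
Proof.
have s2 : Num.sqrt 2 != 0 :> R by rewrite sqrtr_eq0 -ltNge.
(* Comparison with the normal density of variance 2: [exp (x^2 / 4) >= (1 + x^2 / 8)^2 >= x^4 / 64],
   and the quotient of the peaks adjusts the normalizations. *)
pose K := c * 64 / normal_peak (Num.sqrt 2).
have iK : leb.-integrable setT (EFin \o (fun x => K * normal_pdf 0 (Num.sqrt 2) x)).
  have iN : leb.-integrable setT (EFin \o normal_pdf 0 (Num.sqrt 2)).
    by apply: integrable_normal_pdf.
  have H : leb.-integrable setT (fun x => (K%:E * (normal_pdf 0 (Num.sqrt 2) x)%:E)%E).
    by apply: integrableZl => //.
  exact: H.
apply: le_integrable iK => //.
  by apply/measurable_EFinP/measurable_funM => //; exact: measurable_phi.
move=> x _; rewrite /= lee_fin.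
have x4 : 0 <= x ^+ 4 by rewrite -[4%N]/(2 * 2)%N exprM sqr_ge0.
rewrite !ger0_norm; last 2 first.
- rewrite mulr_ge0 ?normal_pdf_ge0//.
  by rewrite /K divr_ge0 ?normal_peak_ge0// mulr_ge0 ?normal_peak_ge0.
- by rewrite mulr_ge0// ltW// phi_gt0.
rewrite phiE normal_pdfE// /normal_fun subr0 sqr_sqrtr// /K.
have -> : - x ^+ 2 / (2 *+ 2) = - (x ^+ 2 / 4) by rewrite mulNr -mulr_natr -natrM.
have pk0 : normal_peak (Num.sqrt 2) != 0 :> R by rewrite gt_eqF// normal_peak_gt0.
have -> : - (x ^+ 2 / 2) = - (x ^+ 2 / 4) + - (x ^+ 2 / 4) by field.
set e := expR (- (x ^+ 2 / 4)).
have -> : c * 64 / normal_peak (Num.sqrt 2) * (normal_peak (Num.sqrt 2) * e) = c * (64 * e).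
  by field.
rewrite expRD mulrCA ler_wpM2l ?normal_peak_ge0// mulrA ler_wpM2r ?expR_ge0//.
rewrite expRN ler_pdivrMr ?expR_gt0//.
have -> : x ^+ 2 / 4 = x ^+ 2 / 8 + x ^+ 2 / 8 by field.
rewrite expRD.
have h := sqr_ge0 x.
have e1 : (1 + x ^+ 2 / 8) * (1 + x ^+ 2 / 8) <= expR (x ^+ 2 / 8) * expR (x ^+ 2 / 8).
  by apply: ler_pM; rewrite ?expR_ge1Dx//; lra.
apply: le_trans (ler_wpM2l _ e1); last by [].
rewrite (_ : x ^+ 4 = x ^+ 2 * x ^+ 2); last by rewrite -exprD.
nra.
Qed.

End gaussian_moments.

(** * Lindeberg's replacement argument *)

Section parametric_integral.
Context d1 d2 (T1 : measurableType d1) (T2 : measurableType d2) (R : realType).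
Variable m1 : {sigma_finite_measure set T1 -> \bar R}.

Lemma measurable_Rintegral_param (F : T1 * T2 -> R) : measurable_fun setT F ->
  measurable_fun setT (fun y => \int[m1]_x F (x, y)).
Proof.
move=> mF; have mEF : measurable_fun setT (EFin \o F) by exact/measurable_EFinP.
have mI : measurable_fun setT (fun y => (\int[m1]_x (F (x, y))%:E)%E).
  rewrite (_ : (fun y => _) =
      (fun y => \int[m1]_x (EFin \o F)^\+ (x, y) - \int[m1]_x (EFin \o F)^\- (x, y))%E).
    apply: emeasurable_funB; apply: measurable_fun_fubini_tonelli_G => //.
      exact: measurable_funepos.
    exact: measurable_funeneg.
  apply/funext => y; rewrite [LHS]integralE.
  by congr (_ - _)%E; apply: eq_integral => x _; rewrite ?funeposE ?funenegE.
by apply: measurableT_comp mI; exact: fine_measurable.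
Qed.

End parametric_integral.

Section centered_data.
Context d (T : measurableType d) (R : realType).
Variable mu : {sigma_finite_measure set T -> \bar R}.

(* Local data given by a density p >= 0 and its score L, the tangent vector
   being L * p. *)
Record centered_data (p L : T -> R) : Prop := CenteredData {
  cd_mp : measurable_fun setT p ;
  cd_mL : measurable_fun setT L ;
  cd_p0 : forall x, 0 <= p x ;
  cd_ip : mu.-integrable setT (EFin \o p) ;
  cd_p1 : \int[mu]_x p x = 1 ;
  cd_i4 : mu.-integrable setT (EFin \o (fun x => p x * L x ^+ 4)) ;
  cd_L0 : \int[mu]_x (p x * L x) = 0 }.

Variables p L : T -> R.
Hypothesis cd : centered_data p L.

Lemma cd_integrable (f : T -> R) (C : R) : measurable_fun setT f ->
  (forall x, `|f x| <= C * (1 + L x ^+ 4)) ->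
  mu.-integrable setT (EFin \o (fun x => p x * f x)).
Proof.
move=> mf fC; have mp := cd_mp cd.
have i1 : mu.-integrable setT (EFin \o (fun x => p x + p x * L x ^+ 4)).
  by apply: eq_integrable (integrableD measurableT (cd_ip cd) (cd_i4 cd)) => // x _.
have i2 : mu.-integrable setT (fun x => (C%:E * (p x + p x * L x ^+ 4)%:E)%E).
  exact: integrableZl.
apply: le_integrable i2 => //; first exact/measurable_EFinP/measurable_funM.
move=> x _; have p0 := cd_p0 cd x.
have L4 : 0 <= L x ^+ 4 by rewrite -[4%N]/(2 * 2)%N exprM sqr_ge0.
have C0 : 0 <= C * (1 + L x ^+ 4) by exact: le_trans (fC x).
rewrite /= lee_fin normrM (ger0_norm p0).
have -> : C * (p x + p x * L x ^+ 4) = p x * (C * (1 + L x ^+ 4)) by ring.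
by rewrite [leRHS]ger0_norm; [exact: ler_wpM2l|exact: mulr_ge0].
Qed.

Lemma cd_integrable_bounded (f : T -> R) (C : R) : measurable_fun setT f ->
  (forall x, `|f x| <= C) -> mu.-integrable setT (EFin \o (fun x => p x * f x)).
Proof.
move=> mf fC; apply: (@cd_integrable _ C) => // x.
have C0 : 0 <= C by exact: le_trans (fC x).
have L4 : 0 <= L x ^+ 4 by rewrite -[4%N]/(2 * 2)%N exprM sqr_ge0.
by rewrite (le_trans (fC x))// ler_peMr// lerDl.
Qed.

Lemma power_le4 (x : R) k : (k <= 4)%N -> `|x ^+ k| <= 1 + x ^+ 4.
Proof.
have x4 : 0 <= x ^+ 4 by rewrite -[4%N]/(2 * 2)%N exprM sqr_ge0.
have -> : x ^+ 4 = `|x| ^+ 4 by rewrite -normrX ger0_norm.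
move=> k4; rewrite normrX; have [x1|x1] := leP `|x| 1.
  by rewrite (le_trans (exprn_ile1 _ _ x1))// lerDl exprn_ge0.
by rewrite (le_trans (ler_weXn2l (ltW x1) k4))// lerDr.
Qed.

Lemma cd_integrableX k : (k <= 4)%N ->
  mu.-integrable setT (EFin \o (fun x => p x * L x ^+ k)).
Proof.
move=> k4; apply: (@cd_integrable _ 1); first exact/measurable_funX/(cd_mL cd).
by move=> x; rewrite mul1r power_le4.
Qed.

Lemma Rintegral_le_bound (f : T -> R) (C : R) : measurable_fun setT f ->
  (forall x, `|f x| <= C) -> `|\int[mu]_x (p x * f x)| <= C.
Proof.
move=> mf fC; have fi := cd_integrable_bounded mf fC.
rewrite (le_trans (le_normr_Rintegral _ fi))//.
apply: (@le_trans _ _ (\int[mu]_x (p x * C))).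
  apply: le_Rintegral => //.
  - exact: integrable_norm.
  - by apply: (@cd_integrable_bounded (fun=> C) C) => // x; rewrite ger0_norm// (le_trans _ (fC x)).
  - by move=> x _; rewrite normrM (ger0_norm (cd_p0 cd x)) ler_wpM2l// (cd_p0 cd).
by rewrite RintegralZr// ?(cd_p1 cd) ?mul1r// (cd_ip cd).
Qed.

(** The expectation of [f (y - a L)] under [p]. Its n-th iterate is the same expectation for a sum
    of n independent copies of [L], see [power_smoothing]. *)
Definition smoothing (a : R) (f : R -> R) (y : R) := \int[mu]_x (p x * f (y - a * L x)).

Lemma measurable_shift_score a (f : R -> R) y : measurable_fun setT f ->
  measurable_fun setT (fun x => f (y - a * L x)).
Proof.
move=> mf; apply: (measurableT_comp mf); apply: measurable_funB => //.
by apply: measurable_funM => //; exact: cd_mL cd.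
Qed.

Lemma measurable_smoothing a (f : R -> R) : measurable_fun setT f ->
  measurable_fun setT (smoothing a f).
Proof.
move=> mf; apply: (@measurable_Rintegral_param _ _ T R R mu (fun z => p z.1 * f (z.2 - a * L z.1))).
apply: measurable_funM; first by apply: measurableT_comp => //; exact: cd_mp cd.
apply: (measurableT_comp mf); apply: measurable_funB => //.
by apply: measurable_funM => //; apply: measurableT_comp => //; exact: cd_mL cd.
Qed.

Lemma smoothing_bounded a (f : R -> R) C : measurable_fun setT f ->
  (forall x, `|f x| <= C) -> forall y, `|smoothing a f y| <= C.
Proof. by move=> mf fC y; apply: Rintegral_le_bound => //; exact: measurable_shift_score. Qed.

Lemma smoothing_integrable a (f : R -> R) C y : measurable_fun setT f ->
  (forall x, `|f x| <= C) ->
  mu.-integrable setT (EFin \o (fun x => p x * f (y - a * L x))).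
Proof.
by move=> mf fC; apply: (@cd_integrable_bounded _ C) => //; exact: measurable_shift_score.
Qed.

Lemma smoothing_contraction a (f h : R -> R) Cf Ch D :
  measurable_fun setT f -> (forall x, `|f x| <= Cf) ->
  measurable_fun setT h -> (forall x, `|h x| <= Ch) ->
  (forall x, `|f x - h x| <= D) ->
  forall y, `|smoothing a f y - smoothing a h y| <= D.
Proof.
move=> mf fC mh hC fhD y; rewrite /smoothing -RintegralB//; last 2 first.
- exact: smoothing_integrable fC.
- exact: smoothing_integrable hC.
rewrite (_ : (fun x => _) = (fun x => p x * (f (y - a * L x) - h (y - a * L x)))); last first.
  by apply/funext => x; rewrite mulrBr.
by apply: Rintegral_le_bound => //; apply: measurable_funB; exact: measurable_shift_score.
Qed.

End centered_data.

Section lindeberg.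
Variable R : realType.

(** Smoothness is recorded as a uniform second-order expansion instead of derivatives, so that
    averaging over translates preserves it without differentiation under the integral. The constant
    [M] must survive all iterations and is a parameter; the bound on [f] itself only ensures
    integrability and is existential. *)
Definition smooth (M : R) (f : R -> R) : Prop :=
  [/\ measurable_fun setT f, exists C, forall x, `|f x| <= C & exists f1 f2 : R -> R,
   [/\ measurable_fun setT f1, measurable_fun setT f2,
      forall x, `|f1 x| <= M, forall x, `|f2 x| <= M &
      forall y h, `|f (y + h) - f y - h * f1 y - h ^+ 2 / 2 * f2 y| <= M * `|h| ^+ 3]].

Context d (T : measurableType d).
Variable mu : {sigma_finite_measure set T -> \bar R}.
Variables p L : T -> R.
Hypothesis cd : centered_data mu p L.

Lemma smooth_smoothing M a f : smooth M f -> smooth M (smoothing mu p L a f).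
Proof.
move=> [mf [C fC] [f1 [f2 [mf1 mf2 f1M f2M fT]]]]; split.
- exact: measurable_smoothing.
- by exists C; exact: smoothing_bounded.
exists (smoothing mu p L a f1), (smoothing mu p L a f2); split.
- exact: measurable_smoothing.
- exact: measurable_smoothing.
- exact: smoothing_bounded.
- exact: smoothing_bounded.
move=> y h; rewrite /smoothing.
have I := @smoothing_integrable _ _ _ _ _ _ cd a.
rewrite -!RintegralZl//; try exact: I f1M; try exact: I f2M.
have i1 := I _ _ (y + h) mf fC; have i2 := I _ _ y mf fC.
have iZ := @integrableZ_EFin _ T R mu.
have i3 := iZ h _ (I _ _ y mf1 f1M); have i4 := iZ (h ^+ 2 / 2) _ (I _ _ y mf2 f2M).
rewrite -RintegralB//.
have i12 : mu.-integrable setT (EFin \o (fun x => p x * f (y + h - a * L x) - p x * f (y - a * L x))).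
  exact: (integrableB measurableT i1 i2).
rewrite -RintegralB//.
rewrite -RintegralB//; last exact: (integrableB measurableT i12 i3).
rewrite (_ : (fun x => _) = (fun x => p x * (f ((y - a * L x) + h) - f (y - a * L x)
   - h * f1 (y - a * L x) - h ^+ 2 / 2 * f2 (y - a * L x)))); last first.
  by apply/funext => x; rewrite (addrAC y); ring.
apply: (Rintegral_le_bound cd) => //.
have mm (e : R -> R) := @measurable_shift_score _ _ _ _ _ _ cd a e y.
apply: measurable_funB; last by apply: measurable_funM => //; exact: mm.
apply: measurable_funB; last by apply: measurable_funM => //; exact: mm.
apply: measurable_funB; last exact: mm.
exact: (mm (fun z => f (z + h)) (measurableT_comp mf (measurable_funD (@measurable_id _ _ _) (measurable_cst _)))).
Qed.

(** An upper bound for the third absolute moment of the score, by |t|^3 <= 1 + t^4. *)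
Let B := 1 + \int[mu]_x (p x * L x ^+ 4).

(** Average the expansion at [y] with increment [- a L]: the linear term vanishes because the score
    is centered, and the quadratic one produces the Fisher information. *)
Lemma smoothing_taylor (M a : R) (f f1 f2 : R -> R) (y : R) : measurable_fun setT f ->
  (exists C, forall x, `|f x| <= C) ->
  (forall y h, `|f (y + h) - f y - h * f1 y - h ^+ 2 / 2 * f2 y| <= M * `|h| ^+ 3) ->
  `|smoothing mu p L a f y - (f y + a ^+ 2 / 2 * f2 y * \int[mu]_x (p x * L x ^+ 2))|
    <= M * `|a| ^+ 3 * B.
Proof.
move=> mf [C fC] fT.
have M0 : 0 <= M by have := le_trans (normr_ge0 _) (fT 0 1); rewrite normr1 expr1n mulr1.
have Ma0 : 0 <= M * `|a| ^+ 3 by rewrite mulr_ge0// exprn_ge0.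
have iZ := @integrableZ_EFin _ T R mu.
have iX k (k4 : (k <= 4)%N) := cd_integrableX cd k4.
have i1 : mu.-integrable setT (EFin \o (fun x => p x * L x)).
  by have := iX 1%N isT; under eq_fun do rewrite expr1.
have ip := cd_ip cd.
have I0 := smoothing_integrable cd a y mf fC.
pose e x := f (y - a * L x) - f y + a * L x * f1 y - (a * L x) ^+ 2 / 2 * f2 y.
have eE : (fun x => p x * e x) = (fun x => (p x * f (y - a * L x) + (- f y) * p x)
    + ((a * f1 y) * (p x * L x) + (- (a ^+ 2 / 2 * f2 y)) * (p x * L x ^+ 2))).
  by apply/funext => x; rewrite /e; ring.
have ia : mu.-integrable setT (EFin \o (fun x => p x * f (y - a * L x) + (- f y) * p x)).
  exact: (integrableD measurableT I0 (iZ _ _ ip)).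
have ib : mu.-integrable setT (EFin \o (fun x => (a * f1 y) * (p x * L x) + (- (a ^+ 2 / 2 * f2 y)) * (p x * L x ^+ 2))).
  exact: (integrableD measurableT (iZ _ _ i1) (iZ _ _ (iX 2%N isT))).
have ie : mu.-integrable setT (EFin \o (fun x => p x * e x)).
  by rewrite eE; exact: (integrableD measurableT ia ib).
have -> : smoothing mu p L a f y - (f y + a ^+ 2 / 2 * f2 y * \int[mu]_x (p x * L x ^+ 2))
    = \int[mu]_x (p x * e x).
  rewrite eE RintegralD// RintegralD//; last exact: iZ.
  rewrite RintegralD//; last 2 first.
  - exact: iZ.
  - exact: iZ (iX 2%N isT).
  rewrite !RintegralZl//; last exact: iX.
  by rewrite (cd_L0 cd) (cd_p1 cd) /smoothing; ring.
rewrite (le_trans (le_normr_Rintegral _ ie))//.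
have iB : mu.-integrable setT (EFin \o (fun x => p x + p x * L x ^+ 4)).
  by apply: eq_integrable (integrableD measurableT ip (cd_i4 cd)) => // x _.
apply: (@le_trans _ _ (\int[mu]_x (M * `|a| ^+ 3 * (p x + p x * L x ^+ 4)))).
  apply: le_Rintegral => //.
  - exact: integrable_norm.
  - exact: iZ.
  move=> x _; rewrite normrM (ger0_norm (cd_p0 cd x)).
  have -> : M * `|a| ^+ 3 * (p x + p x * L x ^+ 4) = p x * (M * `|a| ^+ 3 * (1 + L x ^+ 4)) by ring.
  rewrite ler_wpM2l ?(cd_p0 cd)//.
  have := fT y (- (a * L x)); rewrite normrN normrM exprMn.
  rewrite (_ : _ - _ - _ - _ = e x); last by rewrite /e; ring.
  move/le_trans; apply; rewrite mulrA ler_wpM2l// -normrX.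
  exact: power_le4.
by rewrite RintegralZl// RintegralD// ?(cd_i4 cd)// (cd_p1 cd).
Qed.

End lindeberg.

Section lindeberg_comparison.
Variable R : realType.
Context d (T : measurableType d) d' (T' : measurableType d').
Variable mu : {sigma_finite_measure set T -> \bar R}.
Variable nu : {sigma_finite_measure set T' -> \bar R}.
Variables p L : T -> R.
Variables q K : T' -> R.
Hypothesis cdp : centered_data mu p L.
Hypothesis cdq : centered_data nu q K.
Hypothesis JE : \int[mu]_x (p x * L x ^+ 2) = \int[nu]_x (q x * K x ^+ 2).

(* Replacing the summands one at a time: the two smoothings of a smooth function
   have the same Taylor expansion up to order a ^ 2, and smoothing is a
   contraction for the sup norm. *)
Lemma lindeberg (M : R) (f : R -> R) : smooth M f -> exists2 D, 0 <= D & forall (a : R) n y,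
  `|iter n (smoothing mu p L a) f y - iter n (smoothing nu q K a) f y|
    <= n%:R * (D * `|a| ^+ 3).
Proof.
move=> sf; pose B := 1 + \int[mu]_x (p x * L x ^+ 4); pose B' := 1 + \int[nu]_x (q x * K x ^+ 4).
have M0 : 0 <= M.
  have [_ _ [f1 [f2 [_ _ f1M _ _]]]] := sf; exact: le_trans (f1M 0).
have x40 (x : R) : 0 <= x ^+ 4 by rewrite -[4%N]/(2 * 2)%N exprM sqr_ge0.
have B0 : 0 <= B by rewrite addr_ge0// Rintegral_ge0// => x _; rewrite mulr_ge0// (cd_p0 cdp).
have B0' : 0 <= B' by rewrite addr_ge0// Rintegral_ge0// => x _; rewrite mulr_ge0// (cd_p0 cdq).
exists (M * (B + B')); first by rewrite mulr_ge0// addr_ge0.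
move=> a; elim=> [|n IH] y; first by rewrite /= subrr normr0 mul0r.
have sp : smooth M (iter n (smoothing mu p L a) f).
  by elim: n {IH} => //= n; exact: smooth_smoothing.
have sq : smooth M (iter n (smoothing nu q K a) f).
  by elim: n {IH sp} => //= n; exact: smooth_smoothing.
rewrite !iterS; set F := iter n _ f in IH sp *; set G := iter n _ f in IH sq *.
have [mF [CF FC] _] := sp; have [mG exG [g1 [g2 [_ _ _ _ gT]]]] := sq.
have [CG GC] := exG.
have c1 := smoothing_contraction cdp a mF FC mG GC IH y.
have t1 := smoothing_taylor cdp a y mG exG gT.
have t2 := smoothing_taylor cdq a y mG exG gT.
rewrite JE in t1.
set X := smoothing mu p L a F y in c1 *; set Y := smoothing mu p L a G y in c1 t1.
set Z := smoothing nu q K a G y in t2 *; set W := G y + _ in t1 t2.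
(* [X - Y] inherits the induction bound by contraction. [W] is the common expansion of both
   smoothings of [G], common because of [JE], and each of them differs from it by a third-order
   term. *)
have -> : X - Z = (X - Y) + ((Y - W) - (Z - W)) by ring.
rewrite (le_trans (ler_normD _ _))//.
have -> : n.+1%:R * (M * (B + B') * `|a| ^+ 3) =
  n%:R * (M * (B + B') * `|a| ^+ 3) + (M * `|a| ^+ 3 * B + M * `|a| ^+ 3 * B').
  by rewrite -natr1; ring.
by rewrite lerD// (le_trans (ler_normB _ _))// lerD.
Qed.

End lindeberg_comparison.

Lemma smooth_phi (R : realType) : exists M, smooth M (@normal_pdf R 0 1).
Proof.
have [f1 [f2 [M [mf1 mf2 f1M f2M fT]]]] := phi_taylor R.
exists M; split; first exact: measurable_phi.
  by exists 1; exact: phi_le1.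
by exists f1, f2.
Qed.

(** * Product powers *)

Section powers.
Variables (R : realType) (S : sample_space).
Local Notation mu := (refm R S).
Variables p L : carrier R S -> R.
Hypothesis cd : centered_data mu p L.
Local Notation J := (\int[mu]_x (p x * L x ^+ 2)).

Fixpoint score_sum (n : nat) : carrier R (spow S n) -> R :=
  match n return carrier R (spow S n) -> R with
  | 0 => fun=> 0
  | m.+1 => fun x : carrier R S * carrier R (spow S m) => L x.1 + score_sum x.2
  end.
Arguments score_sum n _ : clear implicits.

Lemma measurable_score_sum n : measurable_fun setT (score_sum n).
Proof.
elim: n => [|n IH]; first exact: measurable_cst.
by apply: measurable_funD; apply: measurableT_comp => //; exact: cd_mL cd.
Qed.

Lemma tpow_ge0 n x : 0 <= tpow p n x.
Proof. by elim: n x => [|n IH] x //=; apply: mulr_ge0; [exact: (cd_p0 cd)|exact: IH]. Qed.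

Lemma tderivE n x : tderiv p (fun y => L y * p y) n x = score_sum n x * tpow p n x.
Proof.
rewrite /tderiv; elim: n x => [|n IH] x /=; first by rewrite big_ord0 mul0r.
rewrite big_ord_recl /= mulrDl; congr (_ + _); first by rewrite mulrA.
rewrite mulrCA -IH mulr_sumr; apply: eq_bigr => i _ /=; congr (_ * _).
Qed.

(** The base case of every induction on powers: [spow S 0] is a point of mass 1. *)
Lemma unit_integral_cst (k : R) : L1fun (SFin tt) (fun=> k) /\
  \int[refm R (SFin tt)]_x k = k.
Proof.
have m1 : (refm R (SFin tt) setT = 1)%E.
  rewrite /refm/= /counting_fin /counting asboolT; last exact: finite_finset.
  rewrite (_ : [set: discrete_fin tt] = [set tt]) ?fset_set1 ?finmap.cardfs1//.
  by apply/seteqP; split => -[].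
split.
  2: by rewrite Rintegral_cst// -[RHS]mulr1; congr (_ * _); exact: (congr1 fine m1).
apply/integrableP; split; first exact/measurable_EFinP.
rewrite /= integral_cst//; apply: (@le_lt_trans _ _ (`|k%:E| * 1)%E); last by rewrite mule1 ltry.
by rewrite le_eqVlt; apply/orP; left; apply/eqP; congr (_ * _)%E; exact: m1.
Qed.

(** The three moments go through one induction because the square of [L + s], with [s] the remaining
    score sum, involves all of them; its cross term is a product of two zero means. *)
Lemma power_moments n :
  [/\ L1fun (spow S n) (tpow p n),
      L1fun (spow S n) (fun x => tpow p n x * score_sum n x),
      L1fun (spow S n) (fun x => tpow p n x * score_sum n x ^+ 2) &
      [/\ \int[refm R (spow S n)]_x tpow p n x = 1,
      \int[refm R (spow S n)]_x (tpow p n x * score_sum n x) = 0 &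
      \int[refm R (spow S n)]_x (tpow p n x * score_sum n x ^+ 2) = n%:R * J]].
Proof.
elim: n => [|n [iP iPS iPS2 [P1 PS PS2]]].
  have cst := unit_integral_cst.
  have c1 := cst 1; have c0 := cst 0.
  have E1 : (fun x => tpow p 0 x * score_sum 0 x) = fun=> 0.
    by apply/funext => x; rewrite /= mulr0.
  have E2 : (fun x => tpow p 0 x * score_sum 0 x ^+ 2) = fun=> 0.
    by apply/funext => x; rewrite /= expr0n/= mulr0.
  rewrite E1 E2 mul0r.
  by split; [exact: c1.1|exact: c0.1|exact: c0.1|split; [exact: c1.2|exact: c0.2|exact: c0.2]].
have i0 := cd_ip cd.
have i1 : L1fun S (fun x => p x * L x).
  by have := cd_integrableX cd (isT : (1 <= 4)%N); under eq_fun do rewrite expr1.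
have i2 : L1fun S (fun x => p x * L x ^+ 2) := cd_integrableX cd (isT : (2 <= 4)%N).
have T f g := @integrable_tensor _ _ _ _ R (refm R S) (refm R (spow S n)) f g.
have V f g := @Rintegral_tensor _ _ _ _ R (refm R S) (refm R (spow S n)) f g.
have t00 := T _ _ i0 iP; have t10 := T _ _ i1 iP; have t01 := T _ _ i0 iPS.
have t20 := T _ _ i2 iP; have t11 := T _ _ i1 iPS; have t02 := T _ _ i0 iPS2.
have v00 := V _ _ i0 iP; have v10 := V _ _ i1 iP; have v01 := V _ _ i0 iPS.
have v20 := V _ _ i2 iP; have v11 := V _ _ i1 iPS; have v02 := V _ _ i0 iPS2.
have E1 : (fun x => tpow p n.+1 x * score_sum n.+1 x) =
  (fun z => p z.1 * L z.1 * tpow p n z.2 + p z.1 * (tpow p n z.2 * score_sum n z.2)).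
  by apply/funext => -[x y]; rewrite /tpow /=; ring.
have E2 : (fun x => tpow p n.+1 x * score_sum n.+1 x ^+ 2) =
  (fun z => (p z.1 * L z.1 ^+ 2 * tpow p n z.2 + 2 * (p z.1 * L z.1 * (tpow p n z.2 * score_sum n z.2)))
     + p z.1 * (tpow p n z.2 * score_sum n z.2 ^+ 2)).
  by apply/funext => -[x y]; rewrite /tpow /=; ring.
have i11 := @L1funZ R (SProd S (spow S n)) 2 _ t11.
have i21 := @L1funD R (SProd S (spow S n)) _ _ t20 i11.
split.
- exact: t00.
- by rewrite E1; exact: (@L1funD R (SProd S (spow S n)) _ _ t10 t01).
- by rewrite E2; exact: (@L1funD R (SProd S (spow S n)) _ _ i21 t02).
split.
- by rewrite [LHS]v00 (cd_p1 cd) P1 mulr1.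
- by rewrite E1 [LHS](RintegralD measurableT t10 t01) v10 v01 PS (cd_L0 cd) mul0r mulr0 addr0.
rewrite E2 [LHS](RintegralD measurableT i21 t02) (RintegralD measurableT t20 i11).
rewrite (RintegralZl 2 measurableT t11) v20 v11 v02 P1 PS PS2 (cd_L0 cd) (cd_p1 cd).
by rewrite mul0r mulr0 addr0 mulr1 mul1r -natr1; ring.
Qed.

(** Fubini with the first coordinate outside: for fixed [x] the shift [a * L x] is absorbed into
    [y], so the induction is over all [y]. *)
Lemma power_smoothing (a : R) (f : R -> R) C n y : measurable_fun setT f ->
  (forall x, `|f x| <= C) ->
  \int[refm R (spow S n)]_x (tpow p n x * f (y - a * score_sum n x)) =
  iter n (smoothing mu p L a) f y.
Proof.
move=> mf fC; elim: n y => [|n IH] y.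
  rewrite (_ : (fun x => _) = (fun=> f y)); first exact: (unit_integral_cst _).2.
  by apply/funext => x; rewrite /tpow/= mul1r mulr0 subr0.
have [iP _ _ _] := power_moments n.
have mP := L1fun_measurable iP.
have mS := @measurable_score_sum n.
pose G (z : carrier R S * carrier R (spow S n)) :=
  p z.1 * tpow p n z.2 * f (y - a * (L z.1 + score_sum n z.2)).
have mG : measurable_fun setT G.
  apply: measurable_funM; first by apply: measurable_tensor => //; exact: cd_mp cd.
  apply: (measurableT_comp mf); apply: measurable_funB => //; apply: measurable_funM => //.
  by apply: measurable_funD; apply: measurableT_comp => //; exact: cd_mL cd.
have C0 : 0 <= C by exact: le_trans (fC 0).
have i0 : L1fun (SProd S (spow S n)) (fun z => p z.1 * tpow p n z.2).
  exact: (integrable_tensor (cd_ip cd) iP).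
have iG : (mu \x refm R (spow S n))%E.-integrable setT (EFin \o G).
  apply: (le_integrable measurableT _ _ (L1funZ C i0)); first exact/measurable_EFinP.
  move=> z _; rewrite /G /= lee_fin normrM [C * _]mulrC [leRHS]normrM (ger0_norm C0).
  by rewrite ler_wpM2l.
transitivity (fine (\int[(mu \x refm R (spow S n))%E]_z (EFin \o G) z)%E) => //.
rewrite -(integral12_prod_meas1 iG) /fubini_F iterS /smoothing /Rintegral; congr fine.
apply: eq_integral => x _; rewrite -IH.
have ix : L1fun (spow S n) (fun z => tpow p n z * f (y - a * L x - a * score_sum n z)).
  have mfx : measurable_fun setT (fun z => f (y - a * L x - a * score_sum n z)).
    by apply: (measurableT_comp mf); apply: measurable_funB => //; apply: measurable_funM.
  apply: (le_integrable measurableT _ _ (L1funZ C iP)); first exact/measurable_EFinP/measurable_funM.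
  move=> z _; rewrite /= lee_fin normrM [C * _]mulrC [leRHS]normrM (ger0_norm C0).
  by rewrite ler_wpM2l.
rewrite EFinM [in RHS]/Rintegral fineK; last exact: integrable_fin_num.
rewrite -integralZl//; apply: eq_integral => z _; rewrite /= /G/= -EFinM; congr (_%:E).
by rewrite mulrA mulrDr opprD addrA.
Qed.

Lemma power_local_data n : local_data (spow S n) (tpow p n) (fun x => score_sum n x * tpow p n x).
Proof.
have [iP iPS iPS2 [P1 PS _]] := power_moments n.
have fE := @integral_of_Rintegral _ _ _ (refm R (spow S n)).
have SC : (fun x => score_sum n x * tpow p n x) = (fun x => tpow p n x * score_sum n x).
  by apply/funext => x; rewrite mulrC.
rewrite SC; apply: local_dataI => //.
- by split => //; [apply: nearW => x; exact: tpow_ge0|exact: fE].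
- exact: fE.
- by apply: nearW => x ->; rewrite mul0r.
rewrite (_ : (fun x => _) = (fun x => tpow p n x * score_sum n x ^+ 2))//.
apply/funext => x; have [->|P0] := eqVneq (tpow p n x) 0; first by rewrite !mul0r expr0n/= mul0r.
by field.
Qed.

End powers.
Arguments score_sum {R S} L n _.

(** * Low normal moments and normal mixtures *)

Section gaussian_low_moments.
Variable R : realType.
Local Notation leb := (@lebesgue_measure R).
Local Notation phi := (@normal_pdf R 0 1).

Lemma integrable_sqr_phi : leb.-integrable setT (EFin \o (fun x : R => x ^+ 2 * phi x)).
Proof.
apply/integrableP; split.
  by apply/measurable_EFinP/measurable_funM => //; exact: measurable_phi.
have <- : (\int[leb]_x (x ^+ 2 * phi x)%:E =
    \int[leb]_x `|(EFin \o (fun x : R => (x ^+ 2 * phi x)%R)) x|)%E.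
  by apply: eq_integral => x _; rewrite /= ger0_norm// mulr_ge0 ?sqr_ge0 ?phi_ge0.
by rewrite integral_sqr_phi ltry.
Qed.

Lemma integrable_x_phi : leb.-integrable setT (EFin \o (fun x : R => x * phi x)).
Proof.
have i2 := integrableD measurableT (integrable_phi R) integrable_sqr_phi.
apply: le_integrable i2 => //.
  by apply/measurable_EFinP/measurable_funM => //; exact: measurable_phi.
move=> x _ /=; rewrite lee_fin normrM (ger0_norm (phi_ge0 x)).
rewrite [leRHS]ger0_norm; last exact: addr_ge0 (phi_ge0 _) (mulr_ge0 (sqr_ge0 _) (phi_ge0 _)).
rewrite -[X in _ <= X + _]mul1r -mulrDl.
rewrite ler_wpM2r ?phi_ge0// ler_norml; apply/andP.
by split; have := sqr_ge0 (x - 1); have := sqr_ge0 (x + 1); nra.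
Qed.

Lemma integral_x_phi : (\int[leb]_x (x * phi x : R)%:E = 0)%E.
Proof.
have m : measurable_fun [set: R] (fun x : R => x * phi x).
  by apply: measurable_funM => //; exact: measurable_phi.
have i := integrable_x_phi.
have iN := integrable_fin_num measurableT i.
have := @integral_oppr R (fun x : R => (x * phi x)%:E) _.
have -> : (\int[leb]_y ((- y) * phi (- y) : R)%:E = \int[leb]_y - (y * phi y : R)%:E)%E.
  by apply: eq_integral => y _; rewrite phiN mulNr.
rewrite integralN/=; last exact: integrable_add_def.
move/(_ (measurable_int _ i)) => E.
move: E iN; rewrite /comp; case: (\int[leb]_x (x * phi x)%:E)%E => // s [] E _.
by congr (_%:E); lra.
Qed.

End gaussian_low_moments.

Section gaussian_mixture.
Variables (R : realType) (S : sample_space).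
Local Notation mu := (refm R S).
Local Notation leb := (@lebesgue_measure R).
Local Notation phi := (@normal_pdf R 0 1).
Variables P W : carrier R S -> R.
Hypothesis iP : L1fun S P.
Hypothesis P0 : forall x, 0 <= P x.
Hypothesis P1 : \int[mu]_x P x = 1.
Hypothesis mW : measurable_fun setT W.

Local Notation mix := (convolution_map P W phi).

Let mP : measurable_fun setT P. Proof. exact: L1fun_measurable. Qed.

Let P1E : (\int[mu]_x (P x)%:E = 1)%E.
Proof. exact: integral_of_Rintegral. Qed.

Lemma mixture_integrable (f : R -> R) C y : measurable_fun setT f -> (forall x, `|f x| <= C) ->
  L1fun S (fun x => P x * f (y - W x)).
Proof.
move=> mf fC; have C0 : 0 <= C by exact: le_trans (fC 0).
have mfx : measurable_fun setT (fun z => f (y - W z)).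
  by apply: (measurableT_comp mf); apply: measurable_funB.
apply: (le_integrable measurableT _ _ (L1funZ C iP)); first exact/measurable_EFinP/measurable_funM.
move=> z _; rewrite /= lee_fin normrM [C * _]mulrC [leRHS]normrM (ger0_norm C0).
by rewrite ler_wpM2l.
Qed.

(** Since [phi] is positive everywhere, a zero of the mixture would force [P] to vanish almost
    everywhere, against its mass 1. The Bayes channel divides by this density at every point. *)
Lemma mixture_gt0 y : 0 < mix y.
Proof.
have i := mixture_integrable y (@measurable_phi R) (@phi_le1 R).
have mix0 : 0 <= mix y by apply: Rintegral_ge0 => x _; rewrite mulr_ge0// phi_ge0.
rewrite lt_neqAle mix0 andbT eq_sym; apply/negP => /eqP m0.
have : (\int[mu]_x `|(P x * phi (y - W x))%:E| = 0)%E.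
  rewrite (eq_integral (fun x => (P x * phi (y - W x))%:E)); last first.
    by move=> x _; rewrite /= ger0_norm// mulr_ge0// phi_ge0.
  transitivity (mix y)%:E; last by rewrite m0.
  by rewrite /convolution_map /Rintegral fineK//; exact: (integrable_fin_num measurableT i).
move/(ae_eq_integral_abs mu measurableT (measurable_int _ i)).1 => ae0.
have : (\int[mu]_x (P x)%:E = \int[mu]_x (cst 0%R x)%:E)%E.
  apply: ae_eq_integral; [by []|exact/measurable_EFinP|exact/measurable_EFinP|].
  apply: filterS ae0 => x /(_ I) [] /eqP; rewrite mulf_eq0 (gt_eqF (phi_gt0 _)) orbF.
  by move=> /eqP ->.
by rewrite P1E integral0 => -[] /eqP; rewrite oner_eq0.
Qed.

Lemma mixture_density : density SReal mix.
Proof.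
have [_ _] := markov_convolution_map iP P0 P1E mW; apply; split.
- exact: integrable_phi.
- by apply: nearW => x; exact: phi_ge0.
- exact: integral_phi.
Qed.

End gaussian_mixture.

(** * Gaussian channels *)

Section gaussian_translates.
Variable R : realType.
Local Notation leb := (@lebesgue_measure R).
Local Notation phi := (@normal_pdf R 0 1).

Lemma translate_integrable (h : R -> R) (w : R) : leb.-integrable setT (EFin \o h) ->
  leb.-integrable setT (EFin \o (fun y : R => h (y - w))) /\
  \int[leb]_y h (y - w) = \int[leb]_y h y.
Proof.
move=> hi; have mh : measurable_fun [set: R] (EFin \o h) := measurable_int _ hi.
split; last by congr fine; exact: (@integral_translation R w (EFin \o h)).
apply/integrableP; split.
  by apply: (measurableT_comp mh); exact: measurable_translation.
have -> : (\int[leb]_x `|(EFin \o (fun y : R => h (y - w)%R)) x| = \int[leb]_x `|(EFin \o h) x|)%E.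
  apply: (@ge0_integral_translation R w (fun y => `|(EFin \o h) y|%E)) => //.
  exact: measurableT_comp.
by case/integrableP : hi.
Qed.

Let fine_E (h : R -> R) (v : R) :
  (\int[leb]_x (h x)%:E = v%:E)%E -> \int[leb]_x h x = v.
Proof. by move=> E; rewrite /Rintegral E. Qed.

Lemma translated_mean (w : R) :
  leb.-integrable setT (EFin \o (fun y : R => y * phi (y - w))) /\
  \int[leb]_y (y * phi (y - w)) = w.
Proof.
have i0 := integrable_phi R; have i1 := integrable_x_phi R.
have iw := integrableZ_EFin w i0.
have i : leb.-integrable setT (EFin \o (fun z : R => z * phi z + w * phi z)).
  exact: (integrableD measurableT i1 iw).
have [I E] := translate_integrable w i.
have F : (fun y : R => (y - w) * phi (y - w) + w * phi (y - w)) = (fun y => y * phi (y - w)).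
  by apply/funext => y; ring.
rewrite F in I E; split => //; rewrite E RintegralD// RintegralZl//.
rewrite (fine_E (integral_x_phi R)) (fine_E (integral_phi R)).
by rewrite mulr1 add0r.
Qed.

Lemma translated_sqr (w : R) :
  leb.-integrable setT (EFin \o (fun y : R => y ^+ 2 * phi (y - w))) /\
  \int[leb]_y (y ^+ 2 * phi (y - w)) = 1 + w ^+ 2.
Proof.
have i0 := integrable_phi R; have i1 := integrable_x_phi R; have i2 := integrable_sqr_phi R.
have iw := integrableZ_EFin (w ^+ 2) i0; have iw1 := integrableZ_EFin (2 * w) i1.
have ia : leb.-integrable setT (EFin \o (fun z : R => z ^+ 2 * phi z + 2 * w * (z * phi z))).
  exact: (integrableD measurableT i2 iw1).
have i : leb.-integrable setT (EFin \o (fun z : R => z ^+ 2 * phi z + 2 * w * (z * phi z) + w ^+ 2 * phi z)).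
  exact: (integrableD measurableT ia iw).
have [I E] := translate_integrable w i.
have F : (fun y : R => (y - w) ^+ 2 * phi (y - w) + 2 * w * ((y - w) * phi (y - w)) + w ^+ 2 * phi (y - w))
   = (fun y => y ^+ 2 * phi (y - w)).
  by apply/funext => y; ring.
rewrite F in I E; split => //; rewrite E RintegralD// RintegralD// !RintegralZl//.
rewrite (fine_E (integral_x_phi R)) (fine_E (integral_phi R)) (fine_E (integral_sqr_phi R)).
by rewrite mulr0 addr0 mulr1.
Qed.

Lemma translated_mass (w : R) : (\int[leb]_y (phi (y - w))%:E = 1)%E.
Proof.
rewrite (@integral_translation R w (fun y => (phi y)%:E)) ?integral_phi//.
by apply/measurable_EFinP; exact: measurable_phi.
Qed.

End gaussian_translates.

Section mixture_moments.
Variables (R : realType) (S : sample_space).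
Local Notation mu := (refm R S).
Local Notation leb := (@lebesgue_measure R).
Local Notation phi := (@normal_pdf R 0 1).
Variables (P W : carrier R S -> R).
Hypothesis iP : L1fun S P.
Hypothesis P0 : forall x, 0 <= P x.
Hypothesis P1 : \int[mu]_x P x = 1.
Hypothesis mW : measurable_fun setT W.
Hypothesis iPW2 : L1fun S (fun x => P x * W x ^+ 2).

(** Fubini, with inner integral [P x * (1 + W x ^+ 2)]: independent variances add. The result
    controls the tails uniformly in n. *)
Lemma mixture_sqr :
  L1fun SReal (fun y : carrier R SReal => y ^+ 2 * convolution_map P W phi y) /\
  \int[leb]_y (y ^+ 2 * convolution_map P W phi y) = 1 + \int[mu]_x (P x * W x ^+ 2).
Proof.
have mP := L1fun_measurable iP.
pose G (z : carrier R S * carrier R SReal) := P z.1 * (z.2 ^+ 2 * phi (z.2 - W z.1)).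
have mG : measurable_fun setT G.
  apply: measurable_funM; first exact: measurableT_comp.
  apply: measurable_funM; first by apply: measurable_funX; exact: measurable_snd.
  exact: (measurable_shifted mW (@measurable_phi R)).
have inner x : (\int[leb]_y (G (x, y))%:E = (P x * (1 + W x ^+ 2))%:E)%E.
  have [I E] := translated_sqr (W x).
  rewrite EFinM -E /Rintegral fineK; last exact: integrable_fin_num.
  by rewrite -integralZl//; apply: eq_integral => y _; rewrite /G/= EFinM.
have G0 z : 0 <= G z by rewrite /G mulr_ge0// mulr_ge0 ?sqr_ge0 ?phi_ge0.
have i1W : L1fun S (fun x => P x + P x * W x ^+ 2) by exact: L1funD.
have iG : (mu \x leb)%E.-integrable setT (EFin \o G).
  have mEG : measurable_fun setT (EFin \o G) by exact/measurable_EFinP.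
  apply: (integrable12ltyP mu leb mEG).2.
  apply: le_lt_trans (integrable_lty measurableT i1W).
  rewrite le_eqVlt; apply/orP; left; apply/eqP; apply: eq_integral => x _.
  transitivity (P x * (1 + W x ^+ 2))%:E; last by rewrite mulrDr mulr1.
  rewrite -inner; apply: eq_integral => y _.
  by rewrite /= ger0_norm.
have mE : (fun y : carrier R SReal => y ^+ 2 * convolution_map P W phi y) = (fun y => \int[mu]_x G (x, y)).
  apply/funext => y; rewrite /convolution_map -RintegralZl//.
    by congr fine; apply: eq_integral => x _; rewrite /G/= mulrCA.
  exact: (mixture_integrable iP mW y (@measurable_phi R) (@phi_le1 R)).
rewrite mE; split; first exact: integrable_marginal iG.
rewrite /Rintegral (integral_marginal iG measurableT) -/(Rintegral _ _ _).
rewrite (eq_integral (fun x => (P x + P x * W x ^+ 2)%:E)); last first.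
  by move=> x _; rewrite inner mulrDr mulr1.
by rewrite -/(Rintegral mu setT (fun x => P x + P x * W x ^+ 2)) RintegralD// P1.
Qed.

End mixture_moments.

Section weighted_distance.
Variable R : realType.
Local Notation leb := (@lebesgue_measure R).

(** Inside [[-B, B]] the weight is at most 1 + B, the difference at most D and the length 2 B.
    Outside, [1 <= B] gives 1 + |y| <= 2 |y| <= 2 y^2 / B, and |f - h| <= f + h leaves second
    moments. The weights used later are 1, for the densities, and y, for the tangent vectors. *)
Lemma weighted_L1_bound (f h w : R -> R) (D B A : R) :
  measurable_fun setT f -> measurable_fun setT h -> measurable_fun setT w ->
  (forall y, 0 <= f y) -> (forall y, 0 <= h y) -> (forall y, `|w y| <= 1 + `|y|) ->
  leb.-integrable setT (EFin \o (fun y : R => y ^+ 2 * f y)) ->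
  leb.-integrable setT (EFin \o (fun y : R => y ^+ 2 * h y)) ->
  \int[leb]_y (y ^+ 2 * f y) <= A -> \int[leb]_y (y ^+ 2 * h y) <= A ->
  (forall y, `|f y - h y| <= D) -> 1 <= B ->
  (L1norm SReal (fun y => (w y * (f y - h y))%R)
    <= ((1 + B) * D * (2 * B) + 2 / B * (A + A))%:E)%E.
Proof.
move=> mf mh mw f0 h0 w1 fi hi fA hA fhD B1.
have B0 : 0 < B by exact: lt_le_trans B1.
have D0 : 0 <= D by exact: le_trans (fhD 0).
rewrite /L1norm Lnorm1.
have mI : measurable (`[- B, B]%classic : set R) by exact: measurable_itv.
pose e (y : R) := (1 + B) * D * \1_(`[- B, B]%classic) y + 2 / B * (y ^+ 2 * f y + y ^+ 2 * h y).
have iI : leb.-integrable setT (EFin \o (fun y : R => (1 + B) * D * \1_(`[- B, B]%classic) y)).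
  apply: integrableZ_EFin; apply: integrable_indic_itv.
have iM : leb.-integrable setT (EFin \o (fun y : R => 2 / B * (y ^+ 2 * f y + y ^+ 2 * h y))).
  by apply: integrableZ_EFin; exact: (integrableD measurableT fi hi).
have ie : leb.-integrable setT (EFin \o e) by exact: (integrableD measurableT iI iM).
apply: (@le_trans _ _ (\int[leb]_y (e y)%:E)%E).
  apply: ge0_le_integral => //.
  - by apply: measurableT_comp => //; apply/measurable_EFinP/measurable_funM => //; exact: measurable_funB.
  - exact: (measurable_int _ ie).
  move=> y _; rewrite /= lee_fin normrM.
  rewrite /e indicE; case: (boolP (y \in _)) => yI.
    rewrite inE/= in_itv/= in yI.
    have yB : `|y| <= B by rewrite ler_norml.
    apply: (@le_trans _ _ ((1 + B) * D)).
      by apply: ler_pM => //; rewrite (le_trans (w1 y))// lerD2l.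
    rewrite mulr1 lerDl; apply: mulr_ge0; first by rewrite divr_ge0// ltW.
    by apply: addr_ge0; apply: mulr_ge0 => //; exact: sqr_ge0.
  have yB : B < `|y|.
    by move: yI; rewrite notin_setE/= in_itv/= -ler_norml => /negP; rewrite -ltNge.
  rewrite mulr0 add0r -mulrDr mulrA.
  apply: ler_pM => //.
    rewrite (le_trans (w1 y))//.
    apply: (@le_trans _ _ (2 * `|y|)); first by have := le_trans B1 (ltW yB); lra.
    rewrite -mulrA ler_wpM2l// -real_normK ?num_real// mulrC ler_pdivlMr// expr2 ler_wpM2l//.
    exact: ltW.
  by rewrite (le_trans (ler_normB _ _))// !ger0_norm.
rewrite [X in (X <= _)%E](_ : _ = (\int[leb]_y e y)%:E); last first.
  by rewrite /Rintegral fineK//; exact: integrable_fin_num.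
rewrite lee_fin /e RintegralD// lerD//.
  rewrite RintegralZl//; last exact: integrable_indic_itv.
  rewrite ler_wpM2l//; first by rewrite mulr_ge0// addr_ge0// ltW.
  rewrite /Rintegral integral_indic//= setIT lebesgue_measure_itv/= lte_fin.
  by case: ifP => _ /=; lra.
rewrite RintegralZl//; last exact: (integrableD measurableT fi hi).
by rewrite RintegralD// ler_wpM2l ?lerD// divr_ge0// ltW.
Qed.

End weighted_distance.

Section gaussian_local_data.
Variable R : realType.
Local Notation leb := (@lebesgue_measure R).
Local Notation phi := (@normal_pdf R 0 1).

Lemma phi_density : density SReal (phi : carrier R SReal -> R).
Proof.
by split; [exact: integrable_phi|apply: nearW => x; exact: phi_ge0|exact: integral_phi].
Qed.

Lemma phi_local_data : local_data SReal (phi : carrier R SReal -> R) (fun x : R => x * phi x).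
Proof.
apply: local_dataI.
- exact: phi_density.
- exact: integrable_x_phi.
- exact: integral_x_phi.
- by apply: nearW => x x0; move: (phi_gt0 x); rewrite x0 ltxx.
apply: eq_integrable (integrable_sqr_phi R) => // x _ /=; congr (_%:E).
have p0 : phi x != 0 by rewrite gt_eqF// phi_gt0.
by field.
Qed.

End gaussian_local_data.

Section gaussian_channel.
Variables (R : realType) (g : prob_functional R).
Arguments g : clear implicits.
Hypothesis g_metric : prob_metric g.
Hypothesis M0 : markov_monotone g.
Variable S : sample_space.
Local Notation mu := (refm R S).
Local Notation leb := (@lebesgue_measure R).
Local Notation phi := (@normal_pdf R 0 1).
Variables (P W : carrier R S -> R) (b : R).
Hypothesis iP : L1fun S P.
Hypothesis P0 : forall x, 0 <= P x.
Hypothesis P1 : \int[mu]_x P x = 1.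
Hypothesis mW : measurable_fun setT W.
Hypothesis ldP : local_data S P (fun x => b * W x * P x).

Local Notation r := (convolution_map P W phi).

Let P1E : (\int[mu]_x (P x)%:E = 1)%E.
Proof. exact: integral_of_Rintegral. Qed.

Lemma gaussian_channel_markov :
  markov_map (density_map (fun z : carrier R S * carrier R SReal => phi (z.2 - W z.1))).
Proof.
apply: markov_density_map.
- exact: (measurable_shifted mW (@measurable_phi R)).
- by move=> z; exact: phi_ge0.
- by move=> x; exact: (translated_mass (W x)).
Qed.

(* The channel x |-> W x + Z, with Z standard normal, sends b W P to a tangent
   vector which need not be b y r; the missing part is the image of b z phi under
   the convolution with the law of W. *)
Lemma gaussian_channel_bound :
  local_data SReal r (fun y : R => b * (y * r y)) /\
  Num.sqrt (g SReal r (fun y : R => b * (y * r y))) <=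
    Num.sqrt (g S P (fun x => b * W x * P x))
    + `|b| * Num.sqrt (g SReal (phi : carrier R SReal -> R) (fun x : R => x * phi x)).
Proof.
have [_ _ _ gZ gD] := g_metric.
have M1 := gaussian_channel_markov.
have M2 := markov_convolution_map iP P0 P1E mW.
have ld1 := markov_local_data ldP M1.
have ld2 := markov_local_data (phi_local_data R) M2.
have g1 := M0 ldP M1; have g2 := M0 (phi_local_data R) M2.
set t := density_map _ (fun x => b * W x * P x) in ld1 g1.
set u := convolution_map P W (fun x : R => x * phi x) in ld2 g2.
rewrite -[density_map _ P]/r in ld1 g1.
have ld2' := local_dataZ b ld2.
(* Under the integral defining [r], write [y = W x + (y - W x)]. *)
have E : (fun y : R => b * (y * r y)) = (fun y => t y + b * u y).
  apply/funext => y; have [[ibWP _] _] := (let: And4 _ td _ _ := ldP in conj td I).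
  have iphi := mixture_integrable iP mW y (@measurable_phi R) (@phi_le1 R).
  have mxphi : measurable_fun setT (fun x : R => x * phi x).
    by apply: measurable_funM => //; exact: measurable_phi.
  have ixphi := mixture_integrable iP mW y mxphi (@x_phi_le R).
  have ib : L1fun S (fun x => b * W x * P x * phi (y - W x)).
    apply: (le_integrable measurableT _ _ ibWP).
      apply/measurable_EFinP; apply: measurable_funM; first exact: L1fun_measurable ibWP.
      apply: (measurableT_comp (@measurable_phi R)); exact: measurable_funB.
    by move=> x _; rewrite /= lee_fin [leLHS]normrM ler_piMr// phi_le1.
  rewrite /t /u /convolution_map /density_map -!RintegralZl//; last exact: (L1funZ y iphi).
  rewrite -RintegralD//; last exact: L1funZ.
  by apply: eq_Rintegral => x _ /=; ring.
have ld := local_dataD ld1 ld2'; rewrite -E in ld; split => //.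
rewrite E (le_trans (gD _ _ _ _ ld1 ld2'))// lerD//; first exact: ler_wsqrtr.
by rewrite gZ// ler_wpM2l// ler_wsqrtr.
Qed.

End gaussian_channel.

Section bayes_channel.
Variable R : realType.
Variable S : sample_space.
Local Notation mu := (refm R S).
Local Notation leb := (@lebesgue_measure R).
Local Notation phi := (@normal_pdf R 0 1).
Variables (Q V : carrier R S -> R).
Hypothesis iQ : L1fun S Q.
Hypothesis Q0 : forall x, 0 <= Q x.
Hypothesis Q1 : \int[mu]_x Q x = 1.
Hypothesis mV : measurable_fun setT V.

Local Notation s := (convolution_map Q V phi).

(* The law of x given V x + Z = y, when x has density Q and Z is standard
   normal. *)
Definition bayes_kernel (z : carrier R SReal * carrier R S) : R :=
  Q z.2 * phi (z.1 - V z.2) / s z.1.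

Lemma bayes_markov : markov_map (density_map bayes_kernel).
Proof.
have s0 y := mixture_gt0 iQ Q0 Q1 mV y.
have ds := mixture_density iQ Q0 Q1 mV.
have ms : measurable_fun setT s by case: ds => i _ _; exact: L1fun_measurable.
apply: markov_density_map.
- apply: measurable_funM.
    apply: measurable_funM.
      by apply: measurableT_comp; [exact: L1fun_measurable|exact: measurable_snd].
    apply: (measurableT_comp (@measurable_phi R)); apply: measurable_funB; first exact: measurable_fst.
    by apply: measurableT_comp => //; exact: measurable_snd.
  apply: (measurableT_comp (@measurable_invr R)).
  by apply: (measurableT_comp ms); exact: measurable_fst.
- by move=> z; rewrite /bayes_kernel divr_ge0 ?mulr_ge0 ?phi_ge0// ltW.
move=> y; rewrite /bayes_kernel /=.
have i := mixture_integrable iQ mV y (@measurable_phi R) (@phi_le1 R).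
under eq_integral do rewrite EFinM.
rewrite integralZr//.
rewrite (_ : (\int[mu]_x (Q x * phi (y - V x))%:E)%E = (s y)%:E); last first.
  by rewrite /convolution_map /Rintegral fineK//; exact: (integrable_fin_num measurableT i).
by rewrite -EFinM divff// gt_eqF.
Qed.

Lemma bayes_mixture : density_map bayes_kernel s = Q.
Proof.
apply/funext => x; rewrite /density_map.
transitivity (\int[leb]_y (Q x * phi (y - V x))).
  apply: eq_Rintegral => y _; rewrite /bayes_kernel/=.
  have s0 : s y != 0 by rewrite gt_eqF// mixture_gt0.
  by field.
have [i E] := translate_integrable (V x) (integrable_phi R).
by rewrite RintegralZl// E /Rintegral integral_phi mulr1.
Qed.

(** The mixture density cancels, and [V x + Z] has mean [V x] for fixed [x]. Hence this direction is
    exact, whereas the forward channel needs a correction. *)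
Lemma bayes_mixture_deriv (b : R) :
  density_map bayes_kernel (fun y : R => b * (y * s y)) = (fun x => b * V x * Q x).
Proof.
apply/funext => x; rewrite /density_map.
transitivity (\int[leb]_y (b * Q x * (y * phi (y - V x)))).
  apply: eq_Rintegral => y _; rewrite /bayes_kernel/=.
  have s0 : s y != 0 by rewrite gt_eqF// mixture_gt0.
  by field.
have [i E] := translated_mean (V x).
by rewrite RintegralZl// E; ring.
Qed.

End bayes_channel.

Section transfer.
Variables (R : realType) (g : prob_functional R).
Arguments g : clear implicits.
Hypothesis g_metric : prob_metric g.
Hypothesis M0 : markov_monotone g.
Variables S S' : sample_space.
Local Notation phi := (@normal_pdf R 0 1).
Variables (P W : carrier R S -> R) (Q V : carrier R S' -> R) (b : R).
Hypothesis iP : L1fun S P.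
Hypothesis P0 : forall x, 0 <= P x.
Hypothesis P1 : \int[refm R S]_x P x = 1.
Hypothesis mW : measurable_fun setT W.
Hypothesis ldP : local_data S P (fun x => b * W x * P x).
Hypothesis iQ : L1fun S' Q.
Hypothesis Q0 : forall x, 0 <= Q x.
Hypothesis Q1 : \int[refm R S']_x Q x = 1.
Hypothesis mV : measurable_fun setT V.
Hypothesis ldQ : local_data S' Q (fun x => b * V x * Q x).

(** The pair [q], [e] is the image of the noisy data of [P] under the Bayes channel of [Q]. That
    channel sends the noisy data of [Q] back to [Q] and its tangent vector exactly, so L^1
    contraction reduces both errors to the distance of the two mixtures. The factor 1 gives both
    bounds the form of [weighted_L1_bound]. *)
Lemma transfer : exists q e : carrier R S' -> R,
  [/\ local_data S' q e,
      Num.sqrt (g S' q e) <= Num.sqrt (g S P (fun x => b * W x * P x))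
        + `|b| * Num.sqrt (g SReal (phi : carrier R SReal -> R) (fun x : R => x * phi x)),
      (L1norm S' (fun x => (q x - Q x)%R) <=
        L1norm SReal (fun y : R => (1 * (convolution_map P W phi y - convolution_map Q V phi y))%R))%E &
      (L1norm S' (fun x => (e x - b * V x * Q x)%R) <=
        `|b|%:E * L1norm SReal (fun y : R => (y * (convolution_map P W phi y - convolution_map Q V phi y))%R))%E].
Proof.
have [ld gb] := gaussian_channel_bound g_metric M0 iP P0 P1 mW ldP.
have [ld' _] := gaussian_channel_bound g_metric M0 iQ Q0 Q1 mV ldQ.
have M := bayes_markov iQ Q0 Q1 mV.
set r := convolution_map P W phi in ld gb *.
set s := convolution_map Q V phi in ld' *.
have mr : measurable_fun setT r := (local_data_measurable ld).1.
have ms : measurable_fun setT s := (local_data_measurable ld').1.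
exists (density_map (bayes_kernel Q V) r), (density_map (bayes_kernel Q V) (fun y : R => b * (y * r y))).
have [[ir _ _] [ir' _] _ _] := ld; have [[is_ _ _] [is' _] _ _] := ld'.
split.
- exact: markov_local_data ld M.
- by apply: le_trans gb; apply: ler_wsqrtr; exact: M0.
- have := markov_contraction M ir is_; rewrite (bayes_mixture iQ Q0 Q1 mV) => /le_trans; apply.
  by under [in X in (_ <= X)%E]eq_fun do rewrite mul1r.
have := markov_contraction M ir' is'; rewrite (bayes_mixture_deriv iQ Q0 Q1 mV) => /le_trans; apply.
rewrite /L1norm !Lnorm1 -ge0_integralZl//.
  rewrite le_eqVlt; apply/orP; left; apply/eqP; apply: eq_integral => y _ /=.
  by rewrite -EFinM -normrM; congr (`|_|%:E); ring.
apply: measurableT_comp => //; apply/measurable_EFinP; apply: measurable_funM => //.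
exact: measurable_funB.
Qed.

End transfer.

(** * Comparison of local data with equal Fisher information *)

Section limits.
Variable R : realType.

(** Fix [B] first, so that [c2 / B] is at most half of the tolerance, and then take n large; this is
    why [c1] may grow with [B] in any manner. *)
Lemma cvg0_of_bounds (u : nat -> \bar R) (c1 : R -> R) (c2 : R) : 0 <= c2 ->
  (forall n, (0 <= u n)%E) ->
  (forall n B, 1 <= B -> (u n <= (c1 B * (Num.sqrt n%:R)^-1 + c2 / B)%:E)%E) ->
  u @ \oo --> 0%E.
Proof.
move=> c20 u0 ub; apply/fine_cvgP; split.
  apply: nearW => n; rewrite ge0_fin_numE//.
  exact: le_lt_trans (ub n 1 (lexx _)) (ltry _).
apply/cvgrPdist_le => e e0.
pose B := 1 + 2 * c2 / e.
have B1 : 1 <= B by rewrite lerDl divr_ge0 ?mulr_ge0// ltW.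
have B0 : 0 < B by exact: lt_le_trans B1.
have c2B : c2 / B <= e / 2.
  rewrite ler_pdivrMr// /B mulrDr mulr1.
  rewrite (_ : e / 2 * (2 * c2 / e) = c2); last by field; rewrite gt_eqF.
  by rewrite lerDr divr_ge0// ltW.
pose k := 2 * (`|c1 B| + 1) / e.
have k0 : 0 < k by rewrite divr_gt0// mulr_gt0// ltr_wpDl.
near=> n.
have nk : k ^+ 2 < n%:R by near: n; exact: nbhs_infty_gtr.
have sn : k < Num.sqrt n%:R.
  by rewrite -(ger0_norm (ltW k0)) -sqrtr_sqr ltr_sqrt// (lt_trans _ nk)// exprn_gt0.
have s0 : 0 < Num.sqrt n%:R :> R by exact: lt_trans sn.
rewrite sub0r normrN /= ger0_norm ?fine_ge0//.
rewrite -lee_fin fineK; last first.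
  rewrite ge0_fin_numE//; exact: le_lt_trans (ub n 1 (lexx _)) (ltry _).
apply: le_trans (ub n B B1) _; rewrite lee_fin.
have -> : e = e / 2 + e / 2 by field.
rewrite lerD//; apply: (@le_trans _ _ (`|c1 B| * (Num.sqrt n%:R)^-1)).
  by rewrite ler_wpM2r ?invr_ge0 ?ler_norm// ltW.
rewrite ler_pdivrMr//.
apply: (@le_trans _ _ (e / 2 * k)); last by apply: ler_wpM2l; [rewrite divr_ge0// ltW|exact: ltW].
rewrite (_ : e / 2 * k = `|c1 B| + 1); first by rewrite lerDl.
by rewrite /k; field; rewrite gt_eqF.
Unshelve. all: by end_near. Qed.

Lemma limn_einf_le_cvg (u : nat -> \bar R) (v : nat -> R) (l : R) :
  (forall n, (u n <= (v n)%:E)%E) -> v @ \oo --> l -> (limn_einf u <= l%:E)%E.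
Proof.
move=> uv vl; have vl' : (EFin \o v) @ \oo --> l%:E by apply/fine_cvgP; split; [exact: nearW|exact: vl].
rewrite -(cvg_limn_einf_sup vl').1 !limn_einf_lim.
apply: lee_lim; [exact: is_cvg_einfs|exact: is_cvg_einfs|].
apply: nearW => n; apply: le_ereal_inf_tmp => _ [m nm <-].
by apply: le_trans (uv m); apply: ereal_inf_lbound; exists m.
Qed.

End limits.

Section comparison.
Variables (R : realType) (g : prob_functional R).
Arguments g : clear implicits.
Hypothesis g_metric : prob_metric g.
Hypothesis M0 : markov_monotone g.
Hypothesis A0 : asymp_additive g.
Hypothesis C0 : asymp_lower_continuous g.
Local Notation phi := (@normal_pdf R 0 1).

Lemma cd_local_data S (p L : carrier R S -> R) : centered_data (refm R S) p L ->
  local_data S p (fun x => L x * p x).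
Proof.
move=> cd; have fE := @integral_of_Rintegral _ _ _ (refm R S).
have i1 : L1fun S (fun x => p x * L x).
  by have := cd_integrableX cd (isT : (1 <= 4)%N); under eq_fun do rewrite expr1.
rewrite (_ : (fun x => L x * p x) = (fun x => p x * L x)); last by apply/funext => x; rewrite mulrC.
apply: local_dataI => //.
- split; [exact: cd_ip cd|apply: nearW => x; exact: cd_p0 cd x|].
  by apply: fE; [exact: cd_ip cd|exact: cd_p1 cd].
- by apply: fE => //; exact: cd_L0 cd.
- by apply: nearW => x ->; rewrite mul0r.
rewrite (_ : (fun x => _) = (fun x => p x * L x ^+ 2)); first exact: (cd_integrableX cd (isT : (2 <= 4)%N)).
apply/funext => x; have [->|P0] := eqVneq (p x) 0; first by rewrite !mul0r expr0n/= mul0r.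
by field.
Qed.

Variables (S S' : sample_space) (p L : carrier R S -> R) (q K : carrier R S' -> R).
Hypothesis cdp : centered_data (refm R S) p L.
Hypothesis cdq : centered_data (refm R S') q K.
Hypothesis JE : \int[refm R S]_x (p x * L x ^+ 2) = \int[refm R S']_x (q x * K x ^+ 2).
Local Notation J := (\int[refm R S]_x (p x * L x ^+ 2)).

Let c := Num.sqrt (g SReal (phi : carrier R SReal -> R) (fun x : R => x * phi x)).

Section fixed_scale.
Variable k : R.
Hypothesis k0 : 0 < k.

(* For n = 0 both are 0, since x / 0 = 0. *)
Let a (n : nat) := k / Num.sqrt n%:R.
Let b (n : nat) := Num.sqrt n%:R / k.

Let sqrt_gt0 n : 0 < Num.sqrt n.+1%:R :> R.
Proof. by rewrite sqrtr_gt0. Qed.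

Lemma rescaled_score T (M : carrier R T -> R) n x :
  b n * (a n * score_sum M n x) = score_sum M n x.
Proof.
(* For n = 0 the product [b n * a n] is 0 instead of 1, but the score sum is empty. *)
case: n x => [|n] x; first by rewrite /= !mulr0.
rewrite mulrA (_ : b n.+1 * a n.+1 = 1) ?mul1r// /a /b; field.
by rewrite !gt_eqF.
Qed.

(** For positive n this is an equality; the inequality absorbs n = 0, where the left side is 0. *)
Lemma rescaled_variance n : a n ^+ 2 * (n%:R * J) <= k ^+ 2 * J.
Proof.
have J0 : 0 <= J by apply: Rintegral_ge0 => x _; rewrite mulr_ge0 ?sqr_ge0// (cd_p0 cdp).
case: n => [|n]; first by rewrite mul0r mulr0 mulr_ge0// sqr_ge0.
by rewrite /a expr_div_n sqr_sqrtr// mulrA divfK//.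
Qed.

Let mixp n := convolution_map (tpow p n) (fun x => a n * score_sum L n x) phi.
Let mixq n := convolution_map (tpow q n) (fun x => a n * score_sum K n x) phi.

Lemma rescaled_moments T (r M : carrier R T -> R) n : centered_data (refm R T) r M ->
  [/\ measurable_fun setT (fun x => a n * score_sum M n x),
   L1fun (spow T n) (fun x => tpow r n x * (a n * score_sum M n x) ^+ 2) &
   \int[refm R (spow T n)]_x (tpow r n x * (a n * score_sum M n x) ^+ 2)
     = a n ^+ 2 * (n%:R * \int[refm R T]_x (r x * M x ^+ 2))].
Proof.
move=> cd; have [iP _ iP2 [_ _ E]] := power_moments cd n.
have F : (fun x => tpow r n x * (a n * score_sum M n x) ^+ 2) =
   (fun x => a n ^+ 2 * (tpow r n x * score_sum M n x ^+ 2)).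
  by apply/funext => x; ring.
split; [|by rewrite F; exact: L1funZ|by rewrite F RintegralZl// E].
by apply: measurable_funM => //; exact: (@measurable_score_sum _ _ _ _ cd n).
Qed.

(** Lindeberg's bound applied to the normal density itself, with n (k / sqrt n)^3 = k^3 / sqrt n. *)
Lemma mixtures_close : exists2 D, 0 <= D & forall n y,
  `|mixp n y - mixq n y| <= D * (Num.sqrt n%:R)^-1.
Proof.
have [M sM] := smooth_phi R.
have [D D0 HD] := lindeberg cdp cdq JE sM.
exists (D * k ^+ 3); first by rewrite mulr_ge0// exprn_ge0// ltW.
move=> n y; have := HD (a n) n y.
rewrite -(power_smoothing cdp (a n) n y (@measurable_phi R) (@phi_le1 R)).
rewrite -(power_smoothing cdq (a n) n y (@measurable_phi R) (@phi_le1 R)).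
move/le_trans; apply; case: n => [|n].
  by rewrite mul0r mulr_ge0 ?invr_ge0 ?sqrtr_ge0// mulr_ge0// exprn_ge0// ltW.
rewrite ger0_norm; last by rewrite divr_ge0// ltW.
rewrite /a -{1}(sqr_sqrtr (ler0n R n.+1)) le_eqVlt; apply/orP; left; apply/eqP; field.
by rewrite gt_eqF.
Qed.

Lemma mixtures_distance : exists (c1 : R -> R) (c2 : R), 0 <= c2 /\
  forall (w : R -> R) n B, measurable_fun setT w -> (forall y, `|w y| <= 1 + `|y|) -> 1 <= B ->
  (L1norm SReal (fun y => (w y * (mixp n y - mixq n y))%R)
    <= (c1 B * (Num.sqrt n%:R)^-1 + c2 / B)%:E)%E.
Proof.
have [D D0 HD] := mixtures_close.
have J0 : 0 <= J by apply: Rintegral_ge0 => x _; rewrite mulr_ge0 ?sqr_ge0// (cd_p0 cdp).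
pose A := 1 + k ^+ 2 * J.
have A1 : 0 <= A by rewrite addr_ge0// mulr_ge0// sqr_ge0.
(* These are read off [weighted_L1_bound] with [D / sqrt n] for the uniform distance; [A] bounds
   both second moments for every n. *)
exists (fun B => (1 + B) * D * (2 * B)), (2 * (A + A)); split; first by rewrite mulr_ge0// addr_ge0.
move=> w n B mw w1 B1.
have [mW iW2 EW] := rescaled_moments n cdp; have [mV iV2 EV] := rescaled_moments n cdq.
have [iP _ _ [P1 _ _]] := power_moments cdp n; have [iQ _ _ [Q1 _ _]] := power_moments cdq n.
have P0 := tpow_ge0 cdp (n:=n); have Q0 := tpow_ge0 cdq (n:=n).
have [ip Ep] := mixture_sqr iP P0 P1 mW iW2; have [iq Eq] := mixture_sqr iQ Q0 Q1 mV iV2.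
have dp := mixture_density iP P0 P1 mW; have dq := mixture_density iQ Q0 Q1 mV.
have mp : measurable_fun setT (mixp n) by case: dp => i _ _; exact: L1fun_measurable.
have mq : measurable_fun setT (mixq n) by case: dq => i _ _; exact: L1fun_measurable.
have Ap : \int[@lebesgue_measure R]_y (y ^+ 2 * mixp n y) <= A.
  by rewrite [leLHS]Ep EW lerD2l rescaled_variance.
have Aq : \int[@lebesgue_measure R]_y (y ^+ 2 * mixq n y) <= A.
  by rewrite [leLHS]Eq EV -JE lerD2l rescaled_variance.
have p0 y : 0 <= mixp n y by rewrite ltW// (mixture_gt0 iP P0 P1 mW).
have q0 y : 0 <= mixq n y by rewrite ltW// (mixture_gt0 iQ Q0 Q1 mV).
have := @weighted_L1_bound R (mixp n) (mixq n) w _ B A mp mq mw p0 q0 w1 ip iq Ap Aq (HD n) B1.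
move=> /le_trans; apply; rewrite lee_fin le_eqVlt; apply/orP; left; apply/eqP.
by ring.
Qed.

Lemma tderiv_score T (r M : carrier R T -> R) n :
  tderiv r (fun x => M x * r x) n = (fun x => b n * (a n * score_sum M n x) * tpow r n x).
Proof. by apply/funext => x; rewrite tderivE rescaled_score. Qed.

Lemma comparison_at_scale :
  g S' q (fun x => K x * q x) <= (Num.sqrt (g S p (fun x => L x * p x)) + c / k) ^+ 2.
Proof.
have [_ g0 _ _ _] := g_metric.
have ldp := cd_local_data cdp; have ldq := cd_local_data cdq.
have ldpn n : local_data (spow S n) (tpow p n) (tderiv p (fun x => L x * p x) n).
  rewrite (_ : tderiv _ _ _ = (fun x => score_sum L n x * tpow p n x)).
    exact: power_local_data cdp n.
  by apply/funext => x; exact: tderivE.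
have ldqn n : local_data (spow S' n) (tpow q n) (tderiv q (fun x => K x * q x) n).
  rewrite (_ : tderiv _ _ _ = (fun x => score_sum K n x * tpow q n x)).
    exact: power_local_data cdq n.
  by apply/funext => x; exact: tderivE.
have tr n : exists qe : (carrier R (spow S' n) -> R) * (carrier R (spow S' n) -> R),
  [/\ local_data (spow S' n) qe.1 qe.2,
      Num.sqrt (g (spow S' n) qe.1 qe.2) <=
        Num.sqrt (g (spow S n) (tpow p n) (tderiv p (fun x => L x * p x) n)) + `|b n| * c,
      (L1norm (spow S' n) (fun x => (qe.1 x - tpow q n x)%R) <=
        L1norm SReal (fun y : R => (1 * (mixp n y - mixq n y))%R))%E &
      (L1norm (spow S' n) (fun x => (qe.2 x - tderiv q (fun x => K x * q x) n x)%R) <=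
        `|b n|%:E * L1norm SReal (fun y : R => (y * (mixp n y - mixq n y))%R))%E].
  have [mW _ _] := rescaled_moments n cdp; have [mV _ _] := rescaled_moments n cdq.
  have [iP _ _ [P1 _ _]] := power_moments cdp n; have [iQ _ _ [Q1 _ _]] := power_moments cdq n.
  have P0 := tpow_ge0 cdp (n:=n); have Q0 := tpow_ge0 cdq (n:=n).
  have lp := ldpn n; have lq := ldqn n; rewrite !tderiv_score in lp lq *.
  have [q' [e' H]] := transfer g_metric M0 iP P0 P1 mW lp iQ Q0 Q1 mV lq.
  by exists (q', e').
(* Choice of the approximating sequence; pairing density and tangent vector in [tr] leaves a single
   choice per n. *)
have {tr} /(_ _)/cid - /all_sig [qe Hqe] := tr.
have [c1 [c2 [c20 bd]]] := mixtures_distance.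
have L1ge0 T (f : carrier R T -> R) : (0 <= L1norm T f)%E by exact: Lnorm_ge0.
have k1 : 0 <= k^-1 by rewrite invr_ge0 ltW.
have w1 : forall y : R, `|(fun=> 1 : R) y| <= 1 + `|y| by move=> y; rewrite normr1 lerDl.
have w2 : forall y : R, `|id y| <= 1 + `|y| by move=> y; rewrite lerDr.
have cv1 : (fun n => L1norm (spow S' n) (fun x => (qe n).1 x - tpow q n x)) @ \oo --> 0%E.
  apply: (cvg0_of_bounds (c1 := c1) c20) => // n B B1.
  have [_ _ h _] := Hqe n; apply: le_trans h _.
  exact: (bd (fun=> 1) n B (measurable_cst _) w1 B1).
have cv2 : (fun n => (Num.sqrt n%:R)^-1%:E * L1norm (spow S' n)
    (fun x => (qe n).2 x - tderiv q (fun x => K x * q x) n x)%R)%E @ \oo --> 0%E.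
  apply: (cvg0_of_bounds (c1 := fun B => k^-1 * c1 B) (c2 := k^-1 * c2)); first exact: mulr_ge0.
    by move=> n; rewrite mule_ge0// lee_fin invr_ge0 sqrtr_ge0.
  move=> n B B1; have [_ _ _ h] := Hqe n.
  have s0 : 0 <= (Num.sqrt n%:R)^-1 :> R by rewrite invr_ge0 sqrtr_ge0.
  apply: le_trans (lee_wpmul2l _ h) _; first by rewrite lee_fin.
  have h2 := bd id n B (@measurable_id _ _ _) w2 B1.
  rewrite muleA -EFinM.
  (* The normalization of tangent vectors in the lower continuity hypothesis cancels the growth of
     [b n]. *)
  have sb : (Num.sqrt n%:R)^-1 * `|b n| <= k^-1.
    rewrite ger0_norm; last by rewrite divr_ge0 ?sqrtr_ge0// ltW.
    case: n {h h2 s0} => [|n]; first by rewrite /b sqrtr0 mul0r mulr0.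
    by rewrite /b mulrA mulVf ?mul1r// gt_eqF.
  apply: le_trans (lee_wpmul2r _ _) (_ : (k^-1%:E * _ <= _)%E).
  - exact: L1ge0.
  - by rewrite lee_fin.
  apply: le_trans (lee_wpmul2l _ h2) _; first by rewrite lee_fin.
  by rewrite -EFinM lee_fin le_eqVlt; apply/orP; left; apply/eqP; ring.
have ldn n : local_data (spow S' n) (qe n).1 (qe n).2 by have [] := Hqe n.
have lim0 := C0 ldq ldn cv1 cv2.
pose gp n := n%:R^-1 * g (spow S n) (tpow p n) (tderiv p (fun x => L x * p x) n).
pose gq n := n%:R^-1 * g (spow S' n) (tpow q n) (tderiv q (fun x => K x * q x) n).
have gpc : gp @ \oo --> g S p (fun x => L x * p x) := A0 ldp.
have gqc : gq @ \oo --> g S' q (fun x => K x * q x) := A0 ldq.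
(* Divided by sqrt n, the noise price [|b n| * c] is at most [c / k], so [v n] dominates the n-th
   term of the lower limit. That lower limit is nonnegative, hence so is the limit of [v]. *)
pose v n := (Num.sqrt (gp n) + c / k) ^+ 2 - gq n.
have vc : v @ \oo --> (Num.sqrt (g S p (fun x => L x * p x)) + c / k) ^+ 2 - g S' q (fun x => K x * q x).
  apply: cvgB => //.
  have sc : (fun n => Num.sqrt (gp n)) @ \oo --> Num.sqrt (g S p (fun x => L x * p x)).
    exact: (cvg_comp _ _ gpc (@sqrt_continuous R _)).
  have sc' : (fun n => Num.sqrt (gp n) + c / k) @ \oo --> Num.sqrt (g S p (fun x => L x * p x)) + c / k.
    by apply: cvgD => //; exact: cvg_cst.
  exact: (cvgM sc' sc').
rewrite -subr_ge0 -lee_fin; apply: le_trans lim0 _.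
apply: limn_einf_le_cvg vc => n; rewrite lee_fin /v mulrBr lerB//.
have c0 : 0 <= c by exact: sqrtr_ge0.
have gqe0 : 0 <= g (spow S' n) (qe n).1 (qe n).2 by exact: g0 (ldn n).
have gpn0 : 0 <= g (spow S n) (tpow p n) (tderiv p (fun x => L x * p x) n) by exact: g0 (ldpn n).
have [_ h _ _] := Hqe n.
rewrite -[g (spow S' n) _ _]sqr_sqrtr//.
rewrite -{1}[n%:R^-1]sqr_sqrtr ?invr_ge0// -exprMn ler_sqr ?nnegrE.
- rewrite /gp sqrtrM ?invr_ge0//.
  apply: le_trans (ler_wpM2l (sqrtr_ge0 _) h) _; rewrite mulrDr lerD2l.
  rewrite ger0_norm; last by rewrite divr_ge0 ?sqrtr_ge0// ltW.
  rewrite mulrA [leRHS]mulrC; apply: ler_wpM2r => //.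
  case: n {h gpn0 gqe0} => [|n]; first by rewrite /b sqrtr0 mul0r mulr0.
  by rewrite sqrtrV// /b mulrA mulVf ?mul1r// gt_eqF.
- by rewrite mulr_ge0 ?sqrtr_ge0.
- by rewrite addr_ge0 ?sqrtr_ge0// divr_ge0// ltW.
Qed.

End fixed_scale.

Lemma comparison : g S' q (fun x => K x * q x) <= g S p (fun x => L x * p x).
Proof.
have [_ g0 _ _ _] := g_metric.
have gp0 := g0 _ _ _ (cd_local_data cdp); have gq0 := g0 _ _ _ (cd_local_data cdq).
have c0 : 0 <= c by exact: sqrtr_ge0.
set x := g S' q _ in gq0 *; set y := g S p _ in gp0 *.
suff : Num.sqrt x <= Num.sqrt y by rewrite ler_sqrt.
apply/ler_addgt0Pr => e e0.
(* For this scale k the error [c / k] is [e c / (c + 1) <= e]; adding 1 keeps k positive even if [c]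
   were 0. *)
have k0 : 0 < (c + 1) / e by rewrite divr_gt0// ltr_wpDl.
have := comparison_at_scale k0; rewrite -/x -/y => h.
have ck : c / ((c + 1) / e) <= e.
  rewrite ler_pdivrMr// mulrC divfK ?gt_eqF//; first by rewrite lerDl.
rewrite (@le_trans _ _ (Num.sqrt y + c / ((c + 1) / e)))// ?lerD2l//.
have s0 : 0 <= Num.sqrt y + c / ((c + 1) / e) by rewrite addr_ge0 ?sqrtr_ge0// divr_ge0// ltW.
by rewrite -(ger0_norm s0) -sqrtr_sqr ler_wsqrtr.
Qed.

End comparison.

(** * Choice of representatives and conclusion *)

Section normalization.
Variables (R : realType) (S : sample_space).
Local Notation mu := (refm R S).
Local Notation phi := (@normal_pdf R 0 1).

(** Densities are nonnegative only almost everywhere, but the Bayes kernel must be nonnegative at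
    every point, so [p] is replaced by its absolute value and [d] by score times density. Only null
    sets are affected, and the metric does not see them. *)
Lemma centered_representative (p d : carrier R S -> R) :
  local_data S p d -> (expect S p (fun x => score S p d x ^+ 4)%R < +oo)%E ->
  exists p' L, [/\ centered_data mu p' L, ae_equal S p p',
    ae_equal S d (fun x => L x * p' x) &
    fisher S p d = (\int[mu]_x (p' x * L x ^+ 2))%:E].
Proof.
move=> ld L4; have [mp md] := local_data_measurable ld.
have Jd := local_data_fisher ld.
have [[ip p0 p1] [id td] pd _] := ld.
pose p' x := `|p x|; pose L x := d x / p' x.
have mp' : measurable_fun setT p' by exact: measurableT_comp.
have mL : measurable_fun setT L by exact: measurable_div.
have pp' : ae_equal S p p' by apply: filterS p0 => x p0; rewrite /p' ger0_norm.
(* Where [p] vanishes, division by 0 makes [L] vanish, in accordance with [d = 0] there. *)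
have dd' : ae_equal S d (fun x => L x * p' x).
  apply: filterS pd => x pd; rewrite /L /p'; have [px0|pn0] := eqVneq (p x) 0.
    by rewrite pd// mul0r mul0r.
  by rewrite divfK// normr_eq0.
have aeL1 (f h : carrier R S -> R) : measurable_fun setT h -> ae_equal S f h -> L1fun S f ->
    L1fun S h /\ (\int[mu]_x (f x)%:E = \int[mu]_x (h x)%:E)%E.
  move=> mh fh fi; have mf := L1fun_measurable fi.
  have E (k : R -> \bar R) : (forall e : carrier R S -> R, measurable_fun setT e -> measurable_fun setT (k \o e)) ->
      (\int[mu]_x k (f x) = \int[mu]_x k (h x))%E.
    move=> mk; apply: ae_eq_integral => //; [exact: mk|exact: mk|].
    by apply: filterS fh => x ->.
  split; last by apply: (E EFin) => e me; exact/measurable_EFinP.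
  apply/integrableP; split; first exact/measurable_EFinP.
  case/integrableP : fi => _; rewrite (E (fun t => `|t%:E|%E))// => e me.
  by apply: measurableT_comp => //; exact/measurable_EFinP.
have [ip' ep'] := aeL1 _ _ mp' pp' ip.
have mpL k : measurable_fun setT (fun x => p' x * L x ^+ k).
  by apply: measurable_funM => //; exact: measurable_funX.
have score_ae k : ae_equal S (fun x => score S p d x ^+ k * p x) (fun x => p' x * L x ^+ k).
  by apply: filterS p0 => x p0; rewrite /score /L /p' ger0_norm// mulrC.
have i4 : L1fun S (fun x => score S p d x ^+ 4 * p x).
  apply: ge0_L1fun => //.
    apply: measurable_funM => //; apply: measurable_funX; exact: measurable_div.
  by apply: filterS p0 => x p0; rewrite mulr_ge0// -[4%N]/(2 * 2)%N exprM sqr_ge0.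
have [i4' _] := aeL1 _ _ (mpL 4%N) (score_ae 4%N) i4.
have i2 : L1fun S (fun x => score S p d x ^+ 2 * p x).
  by under eq_fun do rewrite fisherE.
have [i2' e2'] := aeL1 _ _ (mpL 2%N) (score_ae 2%N) i2.
have mLp : measurable_fun setT (fun x => L x * p' x) by exact: measurable_funM.
have [id' ed'] := aeL1 _ _ mLp dd' id.
exists p', L; split => //.
- split => //.
  + by move=> x; exact: normr_ge0.
  + by rewrite /Rintegral -ep' p1.
  + under eq_Rintegral do rewrite mulrC.
    by rewrite /Rintegral -ed' tangent_integral//; have [] := ld.
by rewrite /fisher /expect [LHS]e2' /Rintegral fineK//; exact: integrable_fin_num.
Qed.

End normalization.

(** The factor [c] tunes the Fisher information of the normal model to c^2, so that it can match any
    [J >= 0]. *)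
Lemma gaussian_centered_data (R : realType) (c : R) :
  centered_data (refm R SReal) (@normal_pdf R 0 1 : carrier R SReal -> R) (fun x : R => c * x).
Proof.
split.
- exact: measurable_phi.
- exact: measurable_funM.
- by move=> x; exact: phi_ge0.
- exact: integrable_phi.
- by rewrite /Rintegral [X in fine X]integral_phi.
- rewrite (_ : (fun x => _) = (fun x : R => c ^+ 4 * (x ^+ 4 * normal_pdf 0 1 x))).
    exact: integrableZ_EFin (integrable_x4_phi R).
  by apply/funext => x; ring.
rewrite (_ : (fun x => _) = (fun x : R => c * (x * normal_pdf 0 1 x))); last first.
  by apply/funext => x; ring.
rewrite [LHS](RintegralZl c measurableT (integrable_x_phi R)).
by rewrite /Rintegral integral_x_phi mulr0.
Qed.

Lemma gaussian_variance (R : realType) (c : R) :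
  \int[refm R SReal]_x (normal_pdf 0 1 (x : R) * (c * x) ^+ 2) = c ^+ 2.
Proof.
rewrite (_ : (fun x => _) = (fun x : R => c ^+ 2 * (x ^+ 2 * normal_pdf 0 1 x))); last first.
  by apply/funext => x; ring.
rewrite [LHS](RintegralZl (c ^+ 2) measurableT (integrable_sqr_phi R)).
by rewrite /Rintegral integral_sqr_phi mulr1.
Qed.

Theorem theorem13 (R : realType) (g : prob_functional R)
  (g_metric : prob_metric g)
  (M0 : markov_monotone g)
  (A0 : asymp_additive g)
  (C0 : asymp_lower_continuous g)
  (N0 : gaussian_normalized g)
  (S : sample_space) (p d : carrier R S -> R)
  (pd : local_data S p d)
  (ab : finite_set [set: carrier R S] \/ stein_condition p d)
  (L4 : (expect S p (fun x => score S p d x ^+ 4)%R < +oo)%E) :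
  (g S p d)%:E = fisher S p d.
Proof.
have [gE g0 _ gZ _] := g_metric.
have [p' [L [cd pp' dd' ->]]] := centered_representative pd L4.
set J := \int[refm R S]_x (p' x * L x ^+ 2).
have J0 : 0 <= J by apply: Rintegral_ge0 => x _; rewrite mulr_ge0 ?sqr_ge0// (cd_p0 cd).
have ld' := cd_local_data cd.
rewrite (gE _ _ _ _ _ pd ld' pp' dd'); congr (_%:E).
pose c := Num.sqrt J.
have cdN := gaussian_centered_data c.
have JE : J = \int[refm R SReal]_x (normal_pdf 0 1 (x : R) * (c * x) ^+ 2).
  by rewrite gaussian_variance sqr_sqrtr.
(* On the line spanned by the normalized tangent vector, homogeneity of sqrt g determines [g], which
   equals c^2. *)
have gN : g SReal (normal_pdf 0 1 : carrier R SReal -> R) (fun x : R => c * x * normal_pdf 0 1 x) = J.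
  have ldN := phi_local_data R.
  have := gZ _ _ c _ ldN; rewrite N0 sqrtr1 mulr1 ger0_norm ?sqrtr_ge0//.
  rewrite (_ : (fun x => c * (x * _)) = (fun x : R => c * x * normal_pdf 0 1 x)); last first.
    by apply/funext => x; rewrite mulrA.
  move=> E; rewrite -[LHS]sqr_sqrtr; last exact: g0 (cd_local_data cdN).
  by rewrite E sqr_sqrtr.
apply/eqP; rewrite eq_le; apply/andP; split; rewrite -gN.
  exact: (comparison g_metric M0 A0 C0 cdN cd (esym JE)).
exact: (comparison g_metric M0 A0 C0 cd cdN JE).
Qed.
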